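(* Let $H$ be a Hamburger Hamiltonian in limit circle case, with lengths $(l_j)_{j=1}^\infty$. Let $d_l,d_\phi:[1,\infty)\to(0,\infty)$ be regularly varying at $\infty$ with indices $-\delta_l$ and $-\delta_\phi$, respectively. Assume that $\delta_\phi\in(0,1)$, and suppose that angles $(\phi_j)_{j=1}^\infty$ of $H$ can be chosen (i.e. there is a real sequence $(\phi_j)_{j=1}^\infty$ with $H=H_{l,\phi}$) such that - $l_j\gtrsim d_l(j)$ and $|\phi_{j+1}-\phi_j|\asymp d_\phi(j)$ for sufficiently large $j$; - $(\phi_j)_{j=1}^\infty$ is eventually monotone. Then, for $r$ sufficiently large, $$\log|w_{H,22}(ir)|\gtrsim r\int_{\left[\frac{d_\phi}{d_l}\right]^-(r)}^\infty d_l(x)\,dx .$$ In particular, $\rho_H\ge\frac{1-\delta_\phi}{\delta_l-\delta_\phi}$.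
   Context: **Hamburger Hamiltonians.** Let $(l_j)_{j=1}^\infty$ be a summable sequence of positive numbers (lengths) and $(\phi_j)_{j=1}^\infty$ a sequence of real numbers (angles) with $\phi_{j+1}-\phi_j\not\equiv 0 \bmod \pi$ for all $j$. Put $x_0=0$, $x_n=\sum_{j=1}^n l_j$, $L=\sum_{j=1}^\infty l_j<\infty$, and $\xi_\phi=(\cos\phi,\sin\phi)^\top$. The Hamburger Hamiltonian $H=H_{l,\phi}$ is the $2\times2$ matrix function on $(0,L)$ with $H_{l,\phi}(t)=\xi_{\phi_j}\xi_{\phi_j}^\top$ for $x_{j-1}\le t<x_j$, $j\ge1$. The lengths are uniquely determined by $H$; the angles are determined only modulo $\pi$ (each $\phi_j$ can be changed by an integer multiple of $\pi$ without changing $H$). Limit circle case means $L<\infty$. **Monodromy matrix and order.** Let $J=\begin{pmatrix}0&-1\\1&0\end{pmatrix}$. For $z\in\mathbb C$ let $W_H(t;z)$ be the solution of $\frac{d}{dt}W_H(t;z)J=zW_H(t;z)H(t)$ for a.e. $t\in[0,L]$, $W_H(0;z)=I$. The monodromy matrix is $W_H(z)=W_H(L;z)$, with entries $w_{H,ij}(z)$, $i,j\in\{1,2\}$; it is entire in $z$. Its order is $\rho_H=\limsup_{r\to\infty}\frac{\log\log\max_{|z|=r}\|W_H(z)\|}{\log r}$. **Regular variation.** A measurable function $a:[1,\infty)\to(0,\infty)$ is regularly varying (at $\infty$) with index $\alpha\in\mathbb R$ if $\lim_{r\to\infty}a(\lambda r)/a(r)=\lambda^\alpha$ for all $\lambda>0$.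 If $\alpha>0$, set $a^-(x)=\sup\{t\in[1,\infty): a(t)<x\}$ (an asymptotic inverse of $a$). **Comparison.** $f\lesssim g$ means that there is a constant $C>0$ with $f\le Cg$; $f\gtrsim g$ means $g\lesssim f$; $f\asymp g$ means both. ''For sufficiently large $x$'' means that there is $x_0$ such that the relation holds on $\{x\ge x_0\}$. *)

(* Defs.v *)
From HB Require Import structures.
From mathcomp Require Export all_boot all_order all_algebra.
From mathcomp Require Export all_classical all_reals all_analysis.
From mathcomp Require Export complex.

Set Implicit Arguments.
Unset Strict Implicit.
Unset Printing Implicit Defensive.

Export Order.TTheory GRing.Theory Num.Theory.
Export numFieldNormedType.Exports.

Local Open Scope classical_set_scope.
Local Open Scope ring_scope.
Local Open Scope complex_scope.

Definition cmod {R : realType} (z : R[i]) : R := ComplexField.Normc.normc z.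

(* Eventual domination along a filter: \oo for sequences, pinfty_nbhs R for
   functions of a real variable. *)
Definition lesssim {R : realType} {T : Type} (F : set_system T)
    (f g : T -> \bar R) : Prop :=
  exists2 C : R, 0 < C & \forall x \near F, (f x <= C%:E * g x)%E.

Definition asymp {R : realType} {T : Type} (F : set_system T)
    (f g : T -> \bar R) : Prop :=
  lesssim F f g /\ lesssim F g f.

(* Only the values of a on [1, +oo[ are meaningful. *)
Definition regularly_varying {R : realType} (a : R -> R) (alpha : R) : Prop :=
  [/\ measurable_fun (`[1, +oo[%classic : set R) a,
      (forall t, 1 <= t -> 0 < a t) &
      (forall lam, 0 < lam ->
         a (lam * r) / a r @[r --> +oo] --> lam `^ alpha)].

Definition asymptotic_inverse {R : realType} (a : R -> R) (x : R) : R :=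
  sup [set t | 1 <= t /\ a t < x].

(* Sequences of lengths and angles are indexed from 1; their values at 0 are
   never used. *)
Definition node {R : realType} (l : nat -> R) (n : nat) : R :=
  \sum_(1 <= j < n.+1) l j.

Definition total_length {R : realType} (l : nat -> R) : R :=
  limn (node l).

Definition xi {R : realType} (phi : R) : 'cV[R]_2 :=
  \col_(i < 2) (if i == 0 then cos phi else sin phi).

(* H is the Hamburger Hamiltonian H_{l,phi}, in limit circle case. *)
Definition hamburger_hamiltonian {R : realType} (l phi : nat -> R)
    (H : R -> 'M[R]_2) : Prop :=
  [/\ (forall j, (1 <= j)%N -> 0 < l j),
      cvgn (node l),
      (forall j, (1 <= j)%N -> forall k : int,
         phi j.+1 - phi j != k%:~R * pi) &
      (forall j, (1 <= j)%N -> forall t,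
         0 < t -> node l j.-1 <= t < node l j ->
         H t = xi (phi j) *m (xi (phi j))^T)].

Definition matJ {R : realType} : 'M[R[i]]_2 :=
  \matrix_(i, j) (if (i == 0) && (j == 1) then -1
                  else if (i == 1) && (j == 0) then 1 else 0).

Definition abs_continuous {R : realType} (a b : R) (f : R -> R[i]) : Prop :=
  forall e : R, 0 < e -> exists2 d : R, 0 < d &
    forall (n : nat) (u v : nat -> R),
      (forall k, (k < n)%N -> a <= u k /\ u k <= v k /\ v k <= b) ->
      trivIset `I_n (fun k => `]u k, v k[%classic) ->
      \sum_(k < n) (v k - u k) < d ->
      \sum_(k < n) cmod (f (v k) - f (u k)) < e.

(* Derivative of a complex-valued function of a real variable. *)
Definition is_cderive {R : realType} (f : R -> R[i]) (t : R) (v : R[i]) : Prop :=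
  is_derive t 1 (fun s => complex.Re (f s)) (complex.Re v) /\
  is_derive t 1 (fun s => complex.Im (f s)) (complex.Im v).

(* w' J = z w H almost everywhere on [0, L], w 0 = I, where as usual solutions
   are understood to be absolutely continuous. *)
Definition fundamental_solution {R : realType} (H : R -> 'M[R]_2) (L : R)
    (z : R[i]) (w : R -> 'M[R[i]]_2) : Prop :=
  [/\ (forall i j, abs_continuous 0 L (fun t => w t i j)),
      w 0 = 1%:M &
      {ae @lebesgue_measure R, forall t, t \in `[0, L] -> forall i j,
         is_cderive (fun s => (w s *m matJ) i j) t
           ((z *: (w t *m map_mx (real_complex R) (H t))) i j)}].

Definition cmx_norm {R : realType} (M : 'M[R[i]]_2) : R :=
  \big[Num.max/0]_(i < 2) \big[Num.max/0]_(j < 2) cmod (M i j).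

Definition max_modulus {R : realType} (F : R[i] -> 'M[R[i]]_2) (r : R) : R :=
  sup [set cmx_norm (F z) | z in [set z | cmod z = r]].

(* The growth order; the choice of the matrix norm does not affect it. *)
Definition growth_order {R : realType} (F : R[i] -> 'M[R[i]]_2) : \bar R :=
  limf_esup (fun r : R => (ln (ln (max_modulus F r)) / ln r)%:E)
            (pinfty_nbhs R).

Definition eventually_monotone {R : realType} (phi : nat -> R) : Prop :=
  exists N : nat,
    nondecreasing_seq (fun n => phi (N + n)%N) \/
    nonincreasing_seq (fun n => phi (N + n)%N).

(* Main.v *)
Require Import Defs.
From mathcomp Require Import measurable_realfun ring lra zify.

Local Open Scope classical_set_scope.
Local Open Scope ring_scope.
Local Open Scope complex_scope.

Set Implicit Arguments.
Unset Strict Implicit.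
Unset Printing Implicit Defensive.

(** Where [H] is constant the canonical system integrates explicitly, so the
    second row [v_n = (a_n, b_n)] of the solution at the node [x_n] obeys
    [v_n = v_(n-1) (I - z l_n xi_n xi_n^T J)], and [b_n] tends to [w_22(z)].
    (The solution is only absolutely continuous and satisfies the equation
    almost everywhere, so this rests on [ac_const_derive].)  The growth of
    [w_22(ir)] is then a question about this linear recursion at [z = ir].

    The energy [E_n = Im (b_n conj a_n)] grows by
    [E_n - E_(n-1) = r l_n |v_(n-1) xi_n|^2].  Since [a_n] is a sum of the
    terms [-i r l_j (v_(j-1) xi_j) sin phi_j], the Cauchy-Schwarz inequality
    gives [|a_n|^2 <= r x_n E_n], and [E_n <= |a_n| |b_n|] then yields
    [E_n <= r x_n |b_n|^2] ([energy_le_snd]).  Hence exponential growth of the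
    energy forces exponential growth of [b_n].  Moreover [|b_n|] increases with
    [n] and with each single length ([csq_snd_incr], [csq_snd_mono]): therefore
    any finite stage bounds [|w_22(ir)|] from below, and all but finitely many
    lengths may be decreased to a constant multiple of [d_l(j)].

    Let [T] be the value of the asymptotic inverse of [d_phi / d_l] at [r].
    Beyond [T] one has [r d_l <= d_phi], and an averaging argument applies
    ([energy_gain_block], [block_gain]).  Over a block of [2 m] consecutive
    indices after [n], with [m] of order [1 / d_phi(n)], the monotone angles turn
    by an amount of order one, while [r] times the length of the block is
    bounded.  So the row vector moves little, and since [xi_i] and [xi_(i+m)]
    are uniformly transversal it cannot be nearly orthogonal to both of them.
    The energy is multiplied by at least [1 + c r m d_l(n)], which is at least
    the exponential of a constant times the sum of [r d_l(j)] over the block.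
    Chaining blocks gives
    [ln |w_22(ir)| >= c r sum_(j > T) d_l(j) - K] ([log_w22_ge_tail_sum]).

    Regular variation enters through two consequences of the convergence of
    [d(lambda x) / d(x)].  First, [d] changes by bounded factors on [[x, 2x]]
    ([regularly_varying_doubling], a weak form of the uniform convergence
    theorem); this compares the tail integral of [d_l] with the tail sum.
    Second, [d] lies between powers with exponents arbitrarily close to its
    index ([regularly_varying_powers]); this shows that [r] times the tail sum
    dominates [r^g] for every [g] below [(1 - delta_phi) / (delta_l - delta_phi)]
    ([tail_sum_lower]).  That absorbs the constant [K] and gives the bound for
    the order. *)

(** The real-valued hypotheses are cleared first: [lia] would try to interpret
    their order relations as relations between integers. *)
Ltac nat_lia := repeat match goal with
  | H : ?T |- _ => lazymatch T with
     | nat => fail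
     | is_true (leq _ _) => fail
     | is_true (leq _ _ && leq _ _) => fail
     | _ => clear H end
  end; lia.

(** * The transfer recursion on the imaginary axis *)

Section Transfer.
Variable R : realType.
Implicit Types (v u : R[i] * R[i]) (l phi : nat -> R) (r a s : R).

(** Squared modulus; unlike [cmod] it is polynomial in the real and imaginary
    parts, so identities about it are within reach of [ring] and [nra]. *)
Definition csq (z : R[i]) : R := complex.Re z ^+ 2 + complex.Im z ^+ 2.

Definition pairing v u : R[i] := v.1 * u.1 + v.2 * u.2.

Definition proj_dir (a : R) v : R[i] := pairing v ((cos a)%:C, (sin a)%:C).

(** The factor [I - z s xi_a xi_a^T J] of one interval of length [s] and angle
    [a], acting on rows; [xi_a^T J] is the row [(sin a, - cos a)]. *)
Definition row_step (z : R[i]) s a v : R[i] * R[i] :=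
  (v.1 - z * s%:C * proj_dir a v * (sin a)%:C,
   v.2 + z * s%:C * proj_dir a v * (cos a)%:C).

(** The same factor acting on columns, that is, the transpose of [row_step] for
    [pairing]. *)
Definition col_step (z : R[i]) s a u : R[i] * R[i] :=
  let q := u.1 * (sin a)%:C - u.2 * (cos a)%:C in
  (u.1 - z * s%:C * (cos a)%:C * q, u.2 - z * s%:C * (sin a)%:C * q).

(** Lengths and angles are indexed from 1: step [n] uses [l n] and [phi n]. *)
Fixpoint row_traj (z : R[i]) l phi v (n : nat) : R[i] * R[i] :=
  if n is m.+1 then row_step z (l n) (phi n) (row_traj z l phi v m) else v.

(** Up to a factor the Hermitian form of [J]: it is nonnegative when [v.2 / v.1]
    lies in the closed upper half-plane. *)
Definition energy v : R := complex.Im (v.2 * (v.1)^*).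

Lemma csq_ge0 z : 0 <= csq z.
Proof. by rewrite addr_ge0 ?sqr_ge0. Qed.

Lemma cmod_csq z : cmod z ^+ 2 = csq z.
Proof.
case: z => x y; rewrite /cmod /csq /= sqr_sqrtr //.
by rewrite addr_ge0 ?sqr_ge0.
Qed.

Lemma csq_scale (t : R[i]) (x : R) : csq (t * x%:C) = x ^+ 2 * csq t.
Proof. by case: t => t1 t2; rewrite /csq /=; simpc => /=; ring. Qed.

Lemma csq_iscale (t : R[i]) r : csq ((0 +i* r) * t) = r ^+ 2 * csq t.
Proof. by case: t => t1 t2; rewrite /csq /=; simpc => /=; ring. Qed.

Lemma csqN (t : R[i]) : csq (- t) = csq t.
Proof. by case: t => t1 t2; rewrite /csq /= !sqrrN. Qed.

Lemma csqD2 (z w : R[i]) : csq z <= 2 * csq (z + w) + 2 * csq w.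
Proof.
case: z w => [x y] [x' y']; rewrite /csq /=.
have := sqr_ge0 (x + 2 * x'); have := sqr_ge0 (y + 2 * y'); nra.
Qed.

(** Two-term Cauchy-Schwarz inequality, in the multiplicative form that an
    induction on the number of steps propagates. *)
Lemma csq_add_cauchy (u w : R[i]) (m e m' e' : R) :
  0 <= m -> 0 <= e -> 0 <= m' -> 0 <= e' ->
  csq u <= m * e -> csq w <= m' * e' -> csq (u + w) <= (m + m') * (e + e').
Proof.
case: u w => [u1 u2] [w1 w2]; rewrite /csq /= => m0 e0 m0' e0' hu hw.
have h0 : 0 <= m * e' + m' * e by rewrite addr_ge0 ?mulr_ge0.
have dot : 2 * (u1 * w1 + u2 * w2) <= m * e' + m' * e.
  apply: le_trans (ler_norm _) _.
  rewrite -[leRHS]ger0_norm // -ler_sqr ?nnegrE // ?real_normK ?num_real //.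
  have h1 : (u1 * w1 + u2 * w2) ^+ 2 <= (u1 ^+ 2 + u2 ^+ 2) * (w1 ^+ 2 + w2 ^+ 2).
    have := sqr_ge0 (u1 * w2 - u2 * w1); nra.
  have h2 : (u1 ^+ 2 + u2 ^+ 2) * (w1 ^+ 2 + w2 ^+ 2) <= (m * e) * (m' * e').
    by apply: ler_pM => //; rewrite addr_ge0 ?sqr_ge0.
  have := sqr_ge0 (m * e' - m' * e); nra.
nra.
Qed.

(** The contribution quadratic in [r s] vanishes because the displacement is a
    scalar multiple of a real row, and real rows have energy zero. *)
Lemma energy_step r s a v :
  energy (row_step (0 +i* r) s a v) = energy v + r * s * csq (proj_dir a v).
Proof.
case: v => [[a1 a2] [b1 b2]]; have := cos2sin2 a.
rewrite /energy /row_step /proj_dir /pairing /csq /=; simpc => /=.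
set c := cos a; set d := sin a => cd.
ring: cd.
Qed.

(** A row cannot be nearly orthogonal to two transversal directions: the Gram
    matrix of the directions has determinant [sin (b - a) ^+ 2] and trace 2, which
    bounds its smallest eigenvalue from below. *)
Lemma csq_rotated_sum a b v :
  sin (b - a) ^+ 2 * (csq v.1 + csq v.2) <=
  2 * (csq (proj_dir a v) + csq (proj_dir b v)).
Proof.
case: v => [[a1 a2] [b1 b2]]; rewrite sinB.
have hb := cos2sin2 b; have ha := cos2sin2 a.
rewrite /proj_dir /pairing /csq /=; simpc => /=.
move: ha hb; set c := cos a; set s := sin a; set c' := cos b; set s' := sin b.
move=> ha hb.
have two (x y : R) :
    (s' * c - c' * s) ^+ 2 * (x ^+ 2 + y ^+ 2) <=
    2 * ((x * c + y * s) ^+ 2 + (x * c' + y * s') ^+ 2).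
  set p := x * c + y * s; set q := x * c' + y * s'; set k := c * c' + s * s'.
  have -> : (s' * c - c' * s) ^+ 2 * (x ^+ 2 + y ^+ 2) =
            p ^+ 2 + q ^+ 2 - 2 * p * q * k.
    rewrite /p /q /k; ring: ha hb.
  have k1 : k ^+ 2 <= 1.
    have -> : k ^+ 2 = 1 - (s' * c - c' * s) ^+ 2 by rewrite /k; ring: ha hb.
    by rewrite gerBl sqr_ge0.
  have h1 : 0 <= (p + q * k) ^+ 2 by exact: sqr_ge0.
  have h2 : 0 <= q ^+ 2 * (1 - k ^+ 2) by rewrite mulr_ge0 ?sqr_ge0 ?subr_ge0.
  have h3 := sqr_ge0 p; have h4 := sqr_ge0 q.
  nra.
have := two a1 b1; have := two a2 b2.
by nra.
Qed.

Lemma row_traj_shift z l phi v n k :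
  row_traj z l phi v (n + k) =
  row_traj z (fun j => l (n + j)%N) (fun j => phi (n + j)%N) (row_traj z l phi v n) k.
Proof. by elim: k => [|k IH]; rewrite ?addn0 // addnS /= IH addnS. Qed.

Lemma node0 l : node l 0 = 0.
Proof. by rewrite /node big_geq. Qed.

Lemma nodeS l n : node l n.+1 = node l n + l n.+1.
Proof. by rewrite /node big_nat_recr. Qed.

(** The integral of the quadratic form of the Hamiltonian along the solution;
    multiplied by [r] it is the energy gained since the start. *)
Definition dissipated l phi (z : R[i]) v n : R :=
  \sum_(1 <= j < n.+1) l j * csq (proj_dir (phi j) (row_traj z l phi v j.-1)).

Lemma dissipatedS l phi z v n :
  dissipated l phi z v n.+1 = dissipated l phi z v n +
    l n.+1 * csq (proj_dir (phi n.+1) (row_traj z l phi v n)).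
Proof. by rewrite /dissipated big_nat_recr. Qed.

Lemma energy_traj l phi r v n :
  energy (row_traj (0 +i* r) l phi v n) =
  energy v + r * dissipated l phi (0 +i* r) v n.
Proof.
elim: n => [|n IH]; first by rewrite /dissipated big_geq // mulr0 addr0.
by rewrite /= energy_step IH dissipatedS; ring.
Qed.

Section Nonneg.
Variables (l phi : nat -> R).
Hypothesis l0 : forall j, (1 <= j)%N -> 0 <= l j.

Lemma node_ge0 n : 0 <= node l n.
Proof. by rewrite /node big_nat_cond sumr_ge0 // => j /andP[/andP[/l0]]. Qed.

Lemma dissipated_ge0 z v n : 0 <= dissipated l phi z v n.
Proof.
rewrite /dissipated big_nat_cond sumr_ge0 // => j /andP[/andP[/l0 lj _] _].
by rewrite mulr_ge0 ?csq_ge0.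
Qed.

Lemma energy_traj_nondecreasing r v n : 0 <= r ->
  energy v <= energy (row_traj (0 +i* r) l phi v n).
Proof. by move=> r0; rewrite energy_traj lerDl mulr_ge0 ?dissipated_ge0. Qed.

(** The displacement of the row tested against a real column is a sum of
    [r l_j p_j] times numbers of modulus at most 1; Cauchy-Schwarz bounds it by the
    total length times the dissipation.  It is used for [u = (1, 0)], which gives
    the first entry, and for directions [xi_a]. *)
Lemma pairing_drift r v u n :
  (forall j, (1 <= j)%N ->
     `|complex.Re u.1 * sin (phi j) - complex.Re u.2 * cos (phi j)| <= 1) ->
  complex.Im u.1 = 0 -> complex.Im u.2 = 0 ->
  csq (pairing (row_traj (0 +i* r) l phi v n) u - pairing v u) <=
  r ^+ 2 * (node l n * dissipated l phi (0 +i* r) v n).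
Proof.
case: u => [[u1 u1'] [u2 u2']] /= hu -> ->.
elim: n => [|n IH].
  by rewrite /= subrr node0 mul0r mulr0 /csq /= expr0n addr0.
rewrite nodeS dissipatedS mulrA (mulrDr (r ^+ 2)); set p := csq (proj_dir _ _).
have -> : pairing (row_traj (0 +i* r) l phi v n.+1) (u1%:C, u2%:C)
          - pairing v (u1%:C, u2%:C) =
  (pairing (row_traj (0 +i* r) l phi v n) (u1%:C, u2%:C)
          - pairing v (u1%:C, u2%:C)) +
  (0 +i* r) * - (proj_dir (phi n.+1) (row_traj (0 +i* r) l phi v n)
     * (l n.+1 * (u1 * sin (phi n.+1) - u2 * cos (phi n.+1)))%:C).
  rewrite /= /row_step /pairing /=.
  set q := proj_dir _ _; rewrite !rmorphM rmorphB !rmorphM /=; ring.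
apply: csq_add_cauchy.
- by rewrite mulr_ge0 ?sqr_ge0 ?node_ge0.
- exact: dissipated_ge0.
- by rewrite mulr_ge0 ?sqr_ge0 ?l0.
- by rewrite mulr_ge0 ?csq_ge0 ?l0.
- by rewrite -mulrA.
rewrite csq_iscale csqN csq_scale -/p.
set t := _ - _.
have -> : r ^+ 2 * ((l n.+1 * t) ^+ 2 * p) =
          r ^+ 2 * l n.+1 * (l n.+1 * (t ^+ 2 * p)) by ring.
apply: ler_wpM2l; first by rewrite mulr_ge0 ?sqr_ge0 ?l0.
apply: ler_wpM2l; first exact: l0.
by rewrite ler_piMl ?csq_ge0 // -real_normK ?num_real // expr_le1 ?hu.
Qed.

Lemma row_step_pairing z s a v u :
  pairing (row_step z s a v) u = pairing v (col_step z s a u).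
Proof. rewrite /pairing /row_step /col_step /proj_dir /pairing /=; ring. Qed.

(** The counterpart of [energy] for columns. *)
Definition flux u : R := complex.Im (u.1 * (u.2)^*).

Lemma flux_col_step r s a u : 0 <= r * s -> flux u <= flux (col_step (0 +i* r) s a u).
Proof.
move=> rs; rewrite -subr_ge0.
suff -> : flux (col_step (0 +i* r) s a u) - flux u =
   r * s * csq (u.1 * (sin a)%:C - u.2 * (cos a)%:C) by rewrite mulr_ge0 ?csq_ge0.
case: u => [[a1 a2] [b1 b2]]; have := cos2sin2 a.
rewrite /flux /col_step /csq /=; simpc => /=.
set c := cos a; set d := sin a => cd.
ring: cd.
Qed.

(** The pairing equals [A - i r s B]; the cross term of its squared modulus is
    [Im (conj A * B)], which is a nonnegative combination of the energy of the row
    and the flux of the column. *)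
Lemma pairing_step_mono r s s' a v u : 0 <= r -> 0 <= s -> s <= s' ->
  0 <= energy v -> 0 <= flux u ->
  csq (pairing (row_step (0 +i* r) s a v) u) <=
  csq (pairing (row_step (0 +i* r) s' a v) u).
Proof.
move=> r0 s0 ss' Ev Fu; rewrite -subr_ge0.
pose q := u.1 * (sin a)%:C - u.2 * (cos a)%:C.
suff -> : csq (pairing (row_step (0 +i* r) s' a v) u) -
   csq (pairing (row_step (0 +i* r) s a v) u) =
   r ^+ 2 * ((s' - s) * (s' + s)) * (csq (proj_dir a v) * csq q)
   + 2 * r * (s' - s) * (csq (proj_dir a v) * flux u + csq q * energy v).
  rewrite addr_ge0 // ?mulr_ge0 ?sqr_ge0 ?csq_ge0 ?subr_ge0 ?addr_ge0 ?mulr_ge0 ?csq_ge0 //.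
  exact: le_trans s0 ss'.
case: v u @q {Ev Fu} => [[a1 a2] [b1 b2]] [[g1 g2] [h1 h2]] /=.
have := cos2sin2 a.
rewrite /energy /row_step /proj_dir /flux /pairing /csq /=; simpc => /=.
set c := cos a; set d := sin a => cd.
ring: cd.
Qed.

Lemma energy_sqr_le v : energy v ^+ 2 <= csq v.1 * csq v.2.
Proof.
case: v => [[a1 a2] [b1 b2]]; rewrite /energy /csq /=.
rewrite -subr_ge0; simpc => /=.
have := sqr_ge0 (a1 * b1 + a2 * b2); nra.
Qed.

Lemma energy_le_half v : 2 * energy v <= csq v.1 + csq v.2.
Proof.
case: v => [[a1 a2] [b1 b2]]; rewrite /energy /csq /=; simpc => /=.
have := sqr_ge0 (a1 - b2); have := sqr_ge0 (a2 + b1); nra.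
Qed.

(** Lengths are replaced one at a time, starting from the last: the steps already
    treated are moved to the column, whose flux stays nonnegative. *)
Lemma row_traj_pairing_mono r l' v u n : 0 <= r -> 0 <= energy v -> 0 <= flux u ->
  (forall j, (1 <= j)%N -> 0 <= l' j <= l j) ->
  csq (pairing (row_traj (0 +i* r) l' phi v n) u) <=
  csq (pairing (row_traj (0 +i* r) l phi v n) u).
Proof.
move=> r0 Ev + hl; elim: n u => [//|n IH] u Fu.
have [l'0 l'l] := andP (hl n.+1 isT).
have E' : 0 <= energy (row_traj (0 +i* r) l' phi v n).
  rewrite energy_traj addr_ge0 // mulr_ge0 //.
  rewrite /dissipated big_nat_cond sumr_ge0 // => j /andP[/andP[/hl/andP[h _] _] _].
  by rewrite mulr_ge0 ?csq_ge0.
apply: le_trans (pairing_step_mono (phi n.+1) r0 l'0 l'l E' Fu) _.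
rewrite /= !row_step_pairing; apply: IH.
by apply: le_trans Fu (flux_col_step _ _ _); rewrite mulr_ge0 ?l0.
Qed.

Definition unit2 : R[i] * R[i] := (0, 1).

Lemma energy_unit2 : energy unit2 = 0.
Proof. by rewrite /energy /=; simpc. Qed.

Lemma pairing_unit2 v : pairing v unit2 = v.2.
Proof. by rewrite /pairing /= mulr0 add0r mulr1. Qed.

Lemma flux_unit2 : flux unit2 = 0.
Proof. by rewrite /flux /=; simpc. Qed.

(** [unit2] also serves as the column that selects the second entry; being real it
    has flux zero. *)
Lemma csq_snd_mono r l' n : 0 <= r ->
  (forall j, (1 <= j)%N -> 0 <= l' j <= l j) ->
  csq (row_traj (0 +i* r) l' phi unit2 n).2 <= csq (row_traj (0 +i* r) l phi unit2 n).2.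
Proof.
by move=> r0 hl; rewrite -!pairing_unit2 row_traj_pairing_mono // ?energy_unit2 ?flux_unit2.
Qed.

(** Removing a step amounts to giving it length 0. *)
Lemma csq_snd_incr r n : 0 <= r ->
  csq (row_traj (0 +i* r) l phi unit2 n).2 <= csq (row_traj (0 +i* r) l phi unit2 n.+1).2.
Proof.
move=> r0; rewrite -!pairing_unit2.
have -> : row_traj (0 +i* r) l phi unit2 n =
          row_step (0 +i* r) 0 (phi n.+1) (row_traj (0 +i* r) l phi unit2 n).
  by rewrite /row_step !(mulr0, mul0r) subr0 addr0; case: row_traj.
apply: pairing_step_mono => //; rewrite ?l0 ?flux_unit2 //.
by apply: le_trans (energy_traj_nondecreasing _ _ _) => //; rewrite energy_unit2.
Qed.

(** Bounding the first entry by the energy is what allows the energy to be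
    estimated by the second entry alone. *)
Lemma csq_fst_le r n : 0 <= r ->
  csq (row_traj (0 +i* r) l phi unit2 n).1 <=
  r * node l n * energy (row_traj (0 +i* r) l phi unit2 n).
Proof.
move=> r0; have := @pairing_drift r unit2 (1, 0) n.
rewrite /pairing /= mul0r add0r !mulr0 addr0 mulr1 subr0 energy_traj energy_unit2 add0r.
have -> : r * node l n * (r * dissipated l phi r*i unit2 n) =
   r ^+ 2 * (node l n * dissipated l phi r*i unit2 n) by ring.
apply => // j _; rewrite mul1r mul0r subr0.
by rewrite ler_norml sin_geN1 sin_le1.
Qed.

(** Combines [csq_fst_le] with [energy <= |v.1| |v.2|] and cancels one factor
    [energy]. *)
Lemma energy_le_snd r n : 0 <= r ->
  energy (row_traj (0 +i* r) l phi unit2 n) <=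
  r * node l n * csq (row_traj (0 +i* r) l phi unit2 n).2.
Proof.
move=> r0; set v := row_traj _ _ _ _ _.
have E0 : 0 <= energy v.
  by apply: le_trans (energy_traj_nondecreasing _ _ _) => //; rewrite energy_unit2.
move: E0; rewrite le_eqVlt => /orP[/eqP <-|E0].
  by rewrite !mulr_ge0 ?node_ge0 ?csq_ge0.
rewrite -(ler_pM2l E0) -expr2; apply: le_trans (energy_sqr_le _) _.
rewrite [leRHS](_ : _ = r * node l n * energy v * csq v.2); last by ring.
by rewrite ler_wpM2r ?csq_ge0 ?csq_fst_le.
Qed.

Lemma dissipated_nondecreasing z v n k : dissipated l phi z v n <= dissipated l phi z v (n + k).
Proof.
elim: k => [|k IH]; first by rewrite addn0.
by rewrite addnS dissipatedS (le_trans IH) // lerDl mulr_ge0 ?csq_ge0 ?l0.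
Qed.

Lemma node_le n k : node l n <= node l (n + k).
Proof.
elim: k => [|k IH]; first by rewrite addn0.
by rewrite addnS nodeS (le_trans IH) // lerDl l0.
Qed.

(** Compares the dissipation with the one of the row frozen at its initial value;
    the comparison is useful as long as [r] times the total length is bounded. *)
Lemma frozen_sum_le r v n :
  \sum_(1 <= j < n.+1) l j * csq (proj_dir (phi j) v) <=
  2 * (1 + (r * node l n) ^+ 2) * dissipated l phi (0 +i* r) v n.
Proof.
set X := dissipated _ _ _ _ _.
have -> : 2 * (1 + (r * node l n) ^+ 2) * X =
  2 * X + 2 * (r ^+ 2 * (node l n * X)) * node l n by ring.
set K := r ^+ 2 * _.
have -> : 2 * X + 2 * K * node l n = \sum_(1 <= j < n.+1)
    l j * (2 * csq (proj_dir (phi j) (row_traj (0 +i* r) l phi v j.-1)) + 2 * K).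
  rewrite /X /dissipated [in 2 * K * _]/node !mulr_sumr -big_split /=.
  by apply: eq_bigr => j _; ring.
rewrite [leLHS]big_nat_cond [leRHS]big_nat_cond.
apply: ler_sum => j /andP[/andP[j1 jn] _].
rewrite ler_wpM2l ?l0 //.
have jn' : (j.-1 <= n)%N by case: j j1 jn => // j _ /ltnW.
have h : r ^+ 2 * (node l j.-1 * dissipated l phi (0 +i* r) v j.-1) <=
         r ^+ 2 * (node l n * X).
  rewrite ler_wpM2l ?sqr_ge0 // ler_pM ?node_ge0 ?dissipated_ge0 //.
    by rewrite -(subnKC jn') node_le.
  by rewrite /X -(subnKC jn') dissipated_nondecreasing.
have drift : csq (proj_dir (phi j) (row_traj (0 +i* r) l phi v j.-1)
               - proj_dir (phi j) v) <= r ^+ 2 * (node l n * X).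
  apply: le_trans h; apply: pairing_drift => //= k _.
  rewrite [X in `|X|](_ : _ = sin (phi k - phi j)); last by rewrite sinB; ring.
  by rewrite ler_norml sin_geN1 sin_le1.
apply: le_trans (csqD2 _ (proj_dir (phi j) (row_traj (0 +i* r) l phi v j.-1)
               - proj_dir (phi j) v)) _.
by rewrite (addrC (proj_dir (phi j) v)) subrK lerD2l ler_wpM2l.
Qed.

Lemma sum_two_halves (F : nat -> R) m :
  \sum_(1 <= j < (m + m).+1) F j = \sum_(0 <= j < m) (F j.+1 + F (m + j.+1)%N).
Proof.
rewrite big_add1 /= (@big_cat_nat _ _ _ m) ?leq_addr //= big_split /=; congr (_ + _).
rewrite -{1}(add0n m) big_addn addnK.
by apply: eq_bigr => i _; rewrite -addSn addnC.
Qed.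

(** Since a row [v] satisfies [csq v.1 + csq v.2 >= 2 * energy v], the frozen row
    dissipates at least a constant times [lam * m] times its energy when index [j]
    is paired with index [m + j]; [frozen_sum_le] transfers this to the solution. *)
Lemma energy_gain_block r v m (lam s C : R) :
  0 <= r -> 0 <= lam -> 0 <= s -> 0 <= energy v ->
  (forall j, (1 <= j <= m + m)%N -> lam <= l j) ->
  (forall j, (1 <= j <= m)%N -> s <= sin (phi (m + j)%N - phi j) ^+ 2) ->
  r * node l (m + m) <= C ->
  (1 + s / (2 * (1 + C ^+ 2)) * (r * lam * m%:R)) * energy v <=
  energy (row_traj (0 +i* r) l phi v (m + m)).
Proof.
move=> r0 lam0 s0 Ev hlam hs hC.
set X := dissipated l phi (0 +i* r) v (m + m).
have C0 : 0 <= C by apply: le_trans hC; rewrite mulr_ge0 ?node_ge0.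
have low : lam * s * energy v * m%:R <=
    \sum_(1 <= j < (m + m).+1) l j * csq (proj_dir (phi j) v).
  rewrite sum_two_halves mulr_natr -[X in _ *+ X]subn0 -sumr_const_nat.
  rewrite [leLHS]big_nat_cond [leRHS]big_nat_cond.
  apply: ler_sum => j /andP[/andP[_ jm] _].
  have h1 : lam <= l j.+1 by apply: hlam => /=; exact: leq_trans jm (leq_addr _ _).
  have h2 : lam <= l (m + j.+1)%N by apply: hlam; rewrite addnS /= ltn_add2l.
  have h3 : s <= sin (phi (m + j.+1)%N - phi j.+1) ^+ 2 by apply: hs.
  have h4 := csq_rotated_sum (phi j.+1) (phi (m + j.+1)%N) v.
  have h5 := energy_le_half v.
  have h6 : s * (2 * energy v) <= 2 * (csq (proj_dir (phi j.+1) v) +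
        csq (proj_dir (phi (m + j.+1)%N) v)).
    apply: le_trans h4; apply: ler_pM => //; rewrite ?mulr_ge0 //.
  apply: (@le_trans _ _ (lam * (csq (proj_dir (phi j.+1) v) +
        csq (proj_dir (phi (m + j.+1)%N) v)))).
    rewrite -mulrA ler_wpM2l // -(ler_pM2l (@ltr0Sn R 1)); apply: le_trans h6.
    by rewrite mulrCA.
  by rewrite mulrDr lerD // ler_wpM2r ?csq_ge0.
have up := frozen_sum_le r v (m + m).
have hX : lam * s * energy v * m%:R <= 2 * (1 + C ^+ 2) * X.
  apply: le_trans low (le_trans up _); rewrite ler_wpM2r ?dissipated_ge0 //.
  by rewrite ler_wpM2l // lerD2l ler_sqr ?nnegrE // ?mulr_ge0 ?node_ge0.
have K0 : 0 < 2 * (1 + C ^+ 2) by rewrite mulr_gt0 // ltr_pwDl ?sqr_ge0.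
rewrite energy_traj mulrDl mul1r lerD2l -/X.
rewrite [leLHS](_ : _ = r * ((lam * s * energy v * m%:R) / (2 * (1 + C ^+ 2)))); last by ring.
by rewrite ler_wpM2l // ler_pdivrMr // (mulrC X).
Qed.

End Nonneg.
End Transfer.

(** * Absolutely continuous functions with constant derivative *)

Section AbsCont.
Variable R : realType.
Implicit Types (f g : R -> R) (a b c t : R).
Local Notation mu := (@lebesgue_measure R).

Definition real_abs_continuous a b f : Prop :=
  forall e : R, 0 < e -> exists2 d : R, 0 < d &
    forall (n : nat) (u v : nat -> R),
      (forall k, (k < n)%N -> a <= u k /\ u k <= v k /\ v k <= b) ->
      trivIset `I_n (fun k => `]u k, v k[%classic) ->
      \sum_(k < n) (v k - u k) < d ->
      \sum_(k < n) `|f (v k) - f (u k)| < e.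

Lemma derive_increment f t c e : is_derive t 1 f c -> 0 < e ->
  exists2 rho, 0 < rho & forall s, `|s - t| < rho ->
    `|f s - f t - c * (s - t)| <= e * `|s - t|.
Proof.
move=> [df dc] e0.
have : (fun h => h^-1 *: ((f \o shift t) (h *: (1 : R)) - f t)) @ 0^' --> c.
  by rewrite -dc; apply: df.
move/cvgrPdist_le => /(_ e e0); rewrite near_withinE /= => /nbhs_ballP[rho /= rho0 H].
exists rho => // s st.
have [->|sNt] := eqVneq s t; first by rewrite !subrr mulr0 subrr normr0 mulr0.
have h0 : s - t != 0 by rewrite subr_eq0.
have := H (s - t); rewrite /= /ball /= sub0r normrN => /(_ st h0).
rewrite scaler1 subrK => h.
rewrite -(ler_pM2r (x := `|s - t|^-1)) ?invr_gt0 ?normr_gt0 //.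
rewrite mulfK ?normr_eq0 // -normfV -normrM.
apply: le_trans h; rewrite -normrN opprB /GRing.scale /= mulrBl mulfK //.
by rewrite mulrC.
Qed.

(** In the covering argument this bounds the total length of the subintervals
    chosen around exceptional points. *)
Lemma disjoint_length (n : nat) (u v : nat -> R) (U : set R) :
  open U ->
  (forall k, (k < n)%N -> u k <= v k) ->
  (forall k, (k < n)%N -> `]u k, v k[ `<=` U) ->
  trivIset `I_n (fun k => `]u k, v k[%classic) ->
  ((\sum_(k < n) (v k - u k))%:E <= mu U)%E.
Proof.
move=> oU uv sub tr.
pose F k : set R := if (k < n)%N then `]u k, v k[%classic else set0.
have mF k : measurable (F k) by rewrite /F; case: ifP.
have trF : trivIset setT F.
  apply/trivIsetP => i j _ _ ij; rewrite /F.
  case: ifPn => hi; last by rewrite set0I.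
  case: ifPn => hj; last by rewrite setI0.
  by move/trivIsetP : tr; apply.
have -> : (\sum_(k < n) (v k - u k))%:E = mu (\big[setU/set0]_(k < n) F k).
  rewrite (@measure_bigsetU _ _ _ mu F) //.
  rewrite -sumEFin; apply: eq_bigr => i _.
  have -> : F i = `]u i, v i[%classic by rewrite /F ltn_ord.
  rewrite [RHS](lebesgue_measure_itv `]u i, v i[) /= lte_fin.
  have := uv i (ltn_ord i); rewrite le_eqVlt => /orP[/eqP ->|->] //.
  by rewrite ltxx subrr.
apply: le_measure; rewrite ?inE.
- by apply: bigsetU_measurable => i _; exact: mF.
- exact: open_measurable.
rewrite -bigcup_mkord => x [k /= kn]; rewrite /F kn; exact: sub.
Qed.

Section ConstantDerivative.
Variables (f : R -> R) (a b c : R) (U : set R) (e : R).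
Hypotheses (e0 : 0 < e) (oU : open U)
  (good : forall t, a <= t <= b -> ~ U t -> is_derive t 1 f c).

(** An interval [a, s] can be cut into finitely many pieces around tags; the pieces
    with a tag outside [U] contribute the error [e * (s - a)], and those with a tag
    in [U] are recorded as the intervals [u k, v k].  Existence of such a
    subdivision is all that is remembered, so that it can be extended to the right. *)
Definition tagged_cover s : Prop := exists n (u v : nat -> R),
  [/\ forall k, (k < n)%N -> a <= u k /\ u k <= v k /\ v k <= s,
      forall k, (k < n)%N -> `]u k, v k[ `<=` U,
      trivIset `I_n (fun k => `]u k, v k[%classic) &
      `|f s - f a - c * (s - a)| <= e * (s - a) +
        \sum_(k < n) (`|f (v k) - f (u k)| + `|c| * (v k - u k)) ].

Lemma tagged_cover_start : tagged_cover a.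
Proof.
exists 0%N, (fun _ => 0), (fun _ => 0); split => //.
by rewrite big_ord0 !subrr !mulr0 subr0 normr0 addr0.
Qed.

(** One piece with tag [t]: inside [U] it is added to the list of exceptional
    intervals, and elsewhere differentiability at [t] bounds the increment. *)
Lemma tagged_cover_extend t : a <= t <= b -> exists2 rho, 0 < rho & forall s s',
  a <= s -> s <= t -> t <= s' -> t - s < rho -> s' - t < rho ->
  tagged_cover s -> tagged_cover s'.
Proof.
move=> tab; have [Ut|nUt] := pselect (U t).
  have /nbhs_ballP[rho /= rho0 H] := open_nbhs_nbhs (conj oU Ut).
  exists rho => // s s' as_ st ts' d1 d2 [n [u [v [huv hU tr hs]]]].
  have ss' : s <= s' by exact: le_trans ts'.
  pose u' k := if (k < n)%N then u k else s.
  pose v' k := if (k < n)%N then v k else s'.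
  exists n.+1, u', v'; split.
  - move=> k _; rewrite /u' /v'; case: ifP => [/huv[h1 [h2 h3]]|_] //.
    by do !split=> //; exact: le_trans ss'.
  - move=> k _; rewrite /u' /v'; case: ifP => [/hU //|_].
    move=> x; rewrite /= in_itv /= => /andP[sx xs']; apply: H.
    by rewrite /ball /= ltr_norml; apply/andP; split; lra.
  - apply/trivIsetP => i j /= hi hj ij.
    have dj k : (k < n)%N -> `]u k, v k[%classic `&` `]s, s'[%classic = set0.
      move=> /huv[h1 [h2 h3]]; apply/seteqP; split=> x //=.
      rewrite !in_itv /= => -[/andP[_ xv] /andP[sx _]].
      by have := lt_le_trans xv h3; rewrite ltNge (ltW sx).
    rewrite /u' /v'; case: (ltnP i n) => hin; case: (ltnP j n) => hjn.
    + by move/trivIsetP : tr; apply.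
    + exact: dj.
    + by rewrite setIC dj.
    + by move/eqP: ij; case; lia.
  - rewrite big_ord_recr /= /u' /v' ltnn.
    rewrite [X in _ + (X + _)](_ : _ =
        \sum_(k < n) (`|f (v k) - f (u k)| + `|c| * (v k - u k))); last first.
      by apply: eq_bigr => k _; rewrite ltn_ord.
    have -> : f s' - f a - c * (s' - a) =
      (f s - f a - c * (s - a)) + ((f s' - f s) - c * (s' - s)) by ring.
    apply: le_trans (ler_normD _ _) _.
    have h1 : `|f s' - f s - c * (s' - s)| <= `|f s' - f s| + `|c| * (s' - s).
      apply: le_trans (ler_normB _ _) _; rewrite normrM (@ger0_norm _ (s' - s)) //.
      by rewrite subr_ge0.
    have h2 : e * (s - a) <= e * (s' - a) by rewrite ler_wpM2l ?(ltW e0) // lerD2r.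
    lra.
have [rho rho0 H] := derive_increment (good tab nUt) e0.
exists rho => // s s' as_ st ts' d1 d2 [n [u [v [huv hU tr hs]]]].
have ss' : s <= s' by exact: le_trans ts'.
exists n, u, v; split => //.
  by move=> k /huv[h1 [h2 h3]]; do !split=> //; exact: le_trans ss'.
have hs1 := H s; have hs2 := H s'.
have E1 : `|s - t| = t - s by rewrite distrC ger0_norm // subr_ge0.
have E2 : `|s' - t| = s' - t by rewrite ger0_norm // subr_ge0.
move: (hs1 ltac:(by rewrite E1)) (hs2 ltac:(by rewrite E2)); rewrite E1 E2 => k1 k2.
have -> : f s' - f a - c * (s' - a) =
   (f s - f a - c * (s - a)) + ((f s' - f t - c * (s' - t)) - (f s - f t - c * (s - t)))
  by ring.
apply: le_trans (ler_normD _ _) _.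
have := ler_normB (f s' - f t - c * (s' - t)) (f s - f t - c * (s - t)).
lra.
Qed.

(** Compactness of the interval in the form of a supremum argument (Cousin's
    lemma). *)
Lemma tagged_cover_all : a <= b -> tagged_cover b.
Proof.
move=> ab; pose S := [set s | a <= s <= b /\ tagged_cover s].
have Sa : S a by split; [rewrite lexx|exact: tagged_cover_start].
have ubS : ubound S b by move=> s [/andP[]].
have hS : has_sup S by split; [exists a | exists b].
pose t := sup S.
have at_ : a <= t by exact: (sup_upper_bound hS Sa).
have tb : t <= b by apply: ge_sup => //; exists a.
have [rho rho0 H] := @tagged_cover_extend t ltac:(by rewrite at_).
have [s [/andP[as_ sb] Ps] ts] := sup_adherent rho0 hS.
have st : s <= t by apply: (sup_upper_bound hS); split => //; rewrite as_.
(* Extending the cover across the supremum [t] exceeds [t] unless [t = b]. *)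
pose s' := Num.min b (t + rho / 2).
have ts' : t <= s' by rewrite /s' le_min tb /= lerDl divr_ge0 // ltW.
have s'le : s' <= t + rho / 2 by rewrite /s' ge_min lexx orbT.
have s'b : s' <= b by rewrite /s' ge_min lexx.
have P' : tagged_cover s'.
  by apply: (H s s') => //; rewrite -/t in ts; lra.
have : s' <= t.
  by apply: (sup_upper_bound hS); split => //; rewrite s'b (le_trans at_).
move: P'; rewrite /s'; case: (leP b (t + rho / 2)) => // _ _; lra.
Qed.

End ConstantDerivative.

(** The exceptional null set is covered by an open set of small measure; the
    exceptional pieces then have small total length, hence contribute little by
    absolute continuity. *)
Lemma ac_const_derive f a b c : a <= b -> real_abs_continuous a b f ->
  {ae mu, forall t, a < t < b -> is_derive t 1 f c} ->
  f b - f a = c * (b - a).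
Proof.
move=> ab acf [N [mN N0 subN]].
apply/eqP; rewrite -subr_eq0 -normr_le0; apply/ler_addgt0Pr => e e0.
rewrite add0r.
pose K := (b - a) + 1 + `|c|.
have K0 : 0 < K by rewrite ltr_pwDl // ltr_wpDl // subr_ge0.
pose e' := e / K; have e'0 : 0 < e' by rewrite divr_gt0.
have [d d0 hd] := acf e' e'0.
pose d' := Num.min d e'; have d'0 : 0 < d' by rewrite lt_min d0.
(* The end points are exceptional too: nothing is known about derivatives there. *)
pose N' := N `|` [set a; b].
have mN' : measurable N' by apply: measurableU => //; exact: measurableU.
have N'0 : mu N' = 0%E.
  rewrite measureU0 //; first exact: measurableU.
  by rewrite measureU0 //; exact: lebesgue_measure_set1.
have [U [oU NU Ud]] : exists U, [/\ open U, N' `<=` U & (mu U < d'%:E)%E].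
  have [|U [oU NU Ud]] := lebesgue_regularity_outer mN' _ d'0.
    by rewrite [X in (X < _)%E]N'0 ltry.
  exists U; split => //; rewrite (_ : U = N' `|` (U `\` N')); last first.
    by rewrite setDUK.
  rewrite setUC measureU0 //; exact: measurableD (open_measurable oU) mN'.
have good t : a <= t <= b -> ~ U t -> is_derive t 1 f c.
  move=> /andP[at_ tb] nU; apply: contrapT => nd; apply: nU; apply: NU.
  have [->|ta] := eqVneq t a; first by right; left.
  have [->|tb'] := eqVneq t b; first by right; right.
  left; apply: subN => /=; apply: contra_not nd; apply.
  by rewrite !lt_neqAle at_ tb eq_sym ta tb'.
have [n [u [v [huv hU tr]]]] := tagged_cover_all e'0 oU good ab.
have len : \sum_(k < n) (v k - u k) < d'.
  rewrite -lte_fin; apply: le_lt_trans Ud; apply: disjoint_length => //.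
  by move=> k /huv[_ []].
have len1 : \sum_(k < n) (v k - u k) < d.
  by apply: lt_le_trans len _; rewrite ge_min lexx.
have var := hd n u v huv tr len1.
have len' : \sum_(k < n) (v k - u k) <= e'.
  by apply: le_trans (ltW len) _; rewrite ge_min lexx orbT.
rewrite big_split /= -mulr_sumr => /le_trans; apply.
have -> : e = e' * (b - a) + (e' + `|c| * e').
  have -> : e = e' * K by rewrite /e' divfK ?gt_eqF.
  by rewrite /K; ring.
by rewrite lerD2l lerD ?(ltW var) // ler_wpM2l.
Qed.

End AbsCont.

(** * From the canonical system to the recursion *)

Section Monodromy.
Variable R : realType.
Implicit Types (f g : R -> R[i]) (a b c t : R).
Local Notation mu := (@lebesgue_measure R).

Lemma ae_impl (P Q : R -> Prop) : (forall t, P t -> Q t) ->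
  {ae mu, forall t, P t} -> {ae mu, forall t, Q t}.
Proof. by move=> PQ; apply: filterS => //; exact: (ae_filter_ringOfSetsType mu). Qed.

Lemma Re_le_cmod (z : R[i]) : `|complex.Re z| <= cmod z.
Proof.
case: z => x y; rewrite /cmod /= -sqrtr_sqr ler_wsqrtr // lerDl sqr_ge0 //.
Qed.

Lemma Im_le_cmod (z : R[i]) : `|complex.Im z| <= cmod z.
Proof.
case: z => x y; rewrite /cmod /= -sqrtr_sqr ler_wsqrtr // lerDr sqr_ge0 //.
Qed.

Lemma cmodD (z w : R[i]) : cmod (z + w) <= cmod z + cmod w.
Proof. exact: le_normcD. Qed.

Lemma cmodM (z w : R[i]) : cmod (z * w) = cmod z * cmod w.
Proof. exact: ComplexField.Normc.normcM. Qed.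

Lemma cmod_real (x : R) : cmod x%:C = `|x|.
Proof. by rewrite /cmod /= expr0n addr0 sqrtr_sqr. Qed.

Lemma cmod_ge0 (z : R[i]) : 0 <= cmod z.
Proof. by case: z => x y; rewrite /cmod /= sqrtr_ge0. Qed.

Lemma cmodN (z : R[i]) : cmod (- z) = cmod z.
Proof. by case: z => x y; rewrite /cmod /= !sqrrN. Qed.

Lemma abs_continuous_lin a b f g (x y : R) :
  abs_continuous a b f -> abs_continuous a b g ->
  abs_continuous a b (fun t => f t * x%:C + g t * y%:C).
Proof.
move=> hf hg e e0.
pose K := `|x| + `|y| + 1.
have K0 : 0 < K by rewrite ltr_wpDl // addr_ge0.
have eK : 0 < e / K by rewrite divr_gt0.
have [d1 d10 h1] := hf _ eK; have [d2 d20 h2] := hg _ eK.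
exists (Num.min d1 d2); first by rewrite lt_min d10.
move=> n u v huv tr; rewrite lt_min => /andP[l1 l2].
have s1 := h1 n u v huv tr l1; have s2 := h2 n u v huv tr l2.
apply: (@le_lt_trans _ _ (\sum_(k < n) (cmod (f (v k) - f (u k)) * `|x| +
                                    cmod (g (v k) - g (u k)) * `|y|))).
  apply: ler_sum => k _; rewrite -!cmod_real -!cmodM.
  apply: le_trans (cmodD _ _); rewrite le_eqVlt; apply/orP; left; apply/eqP.
  by congr cmod; ring.
rewrite big_split /= -!mulr_suml.
apply: (@le_lt_trans _ _ (e / K * `|x| + e / K * `|y|)).
  by rewrite lerD // ler_wpM2r // ltW.
rewrite -mulrDr mulrAC ltr_pdivrMr // ltr_pM2l // /K; lra.
Qed.

Lemma abs_continuousW a b c d f : a <= c -> d <= b ->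
  abs_continuous a b f -> abs_continuous c d f.
Proof.
move=> ac db hf e /hf[r r0 h]; exists r => // n u v huv; apply: h => k /huv[h1 [h2 h3]].
by split; [exact: le_trans h1|split => //; exact: le_trans db].
Qed.

Lemma abs_continuous_part a b f (pr : R[i] -> R) :
  (forall z w, pr (z - w) = pr z - pr w) -> (forall z, `|pr z| <= cmod z) ->
  abs_continuous a b f -> real_abs_continuous a b (pr \o f).
Proof.
move=> prB prle hf e /hf[r r0 h]; exists r => // n u v huv tr lt.
apply: le_lt_trans (h n u v huv tr lt); apply: ler_sum => k _.
by rewrite /= -prB.
Qed.

Lemma complex_ac_const_derive f a b (v : R[i]) : a <= b -> abs_continuous a b f ->
  {ae mu, forall t, a < t < b -> is_cderive f t v} ->
  f b = f a + v * (b - a)%:C.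
Proof.
move=> ab acf hd.
have hR : complex.Re (f b) - complex.Re (f a) = complex.Re v * (b - a).
  apply: (@ac_const_derive R (fun t => complex.Re (f t))) => //.
    apply: abs_continuous_part acf; last exact: Re_le_cmod.
    by move=> [? ?] [? ?].
  by apply: ae_impl hd => t h /h[].
have hI : complex.Im (f b) - complex.Im (f a) = complex.Im v * (b - a).
  apply: (@ac_const_derive R (fun t => complex.Im (f t))) => //.
    apply: abs_continuous_part acf; last exact: Im_le_cmod.
    by move=> [? ?] [? ?].
  by apply: ae_impl hd => t h /h[].
move: hR hI; case: (f b) => x y; case: (f a) => x' y'; case: v {hd} => p q /=.
move=> hR hI; simpc.
by rewrite -hR -hI; congr (_ +i* _); ring.
Qed.

Lemma is_cderive_lin f g t (v w : R[i]) (x y : R) :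
  is_cderive f t v -> is_cderive g t w ->
  is_cderive (fun s => f s * x%:C + g s * y%:C) t (v * x%:C + w * y%:C).
Proof.
move=> [fR fI] [gR gI]; split.
  have -> : (fun s => complex.Re (f s * x%:C + g s * y%:C)) =
     x *: (fun s => complex.Re (f s)) + y *: (fun s => complex.Re (g s)).
    apply/funext => s; rewrite -[RHS]/(x * complex.Re (f s) + y * complex.Re (g s)) /=.
    by case: (f s) => ? ?; case: (g s) => ? ? /=; ring.
  have -> : complex.Re (v * x%:C + w * y%:C) = x *: complex.Re v + y *: complex.Re w.
    by case: v {fR fI} => ? ?; case: w {gR gI} => ? ? /=; rewrite /GRing.scale /=; ring.
  by apply: is_deriveD.
have -> : (fun s => complex.Im (f s * x%:C + g s * y%:C)) =
     x *: (fun s => complex.Im (f s)) + y *: (fun s => complex.Im (g s)).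
  apply/funext => s; rewrite -[RHS]/(x * complex.Im (f s) + y * complex.Im (g s)) /=.
    by case: (f s) => ? ?; case: (g s) => ? ? /=; ring.
have -> : complex.Im (v * x%:C + w * y%:C) = x *: complex.Im v + y *: complex.Im w.
  by case: v {fR fI} => ? ?; case: w {gR gI} => ? ? /=; rewrite /GRing.scale /=; ring.
by apply: is_deriveD.
Qed.

Section Hamburger.
Variables (l phi : nat -> R) (H : R -> 'M[R]_2).
Hypothesis hH : hamburger_hamiltonian l phi H.
Let L := total_length l.

Lemma lengths_ge0 j : (1 <= j)%N -> 0 <= l j.
Proof. by case: hH => l0 _ _ _ /l0/ltW. Qed.

Lemma node_nondecreasing : nondecreasing_seq (node l).
Proof.
move=> m n mn; rewrite -(subnKC mn); apply: node_le.
exact: lengths_ge0.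
Qed.

Lemma node_le_length n : node l n <= L.
Proof.
case: hH => _ cv _ _; exact: (nondecreasing_cvgn_le node_nondecreasing cv).
Qed.

Lemma mul_matJ (M : 'M[R[i]]_2) i :
  ((M *m matJ) i 0 = M i 1) * ((M *m matJ) i 1 = - M i 0).
Proof.
have e1 : lift ord0 ord0 = 1 :> 'I_2 by apply: val_inj.
split; rewrite mxE big_ord_recl big_ord1 !mxE /= e1.
  by rewrite mulr0 add0r mulr1.
by rewrite mulrN1 mulr0 addr0.
Qed.

Lemma mul_rank_one (M : 'M[R[i]]_2) (z : R[i]) (a : R) i j :
  (z *: (M *m map_mx (real_complex R) (xi a *m (xi a)^T))) i j =
  z * proj_dir a (M i 0, M i 1) * (if j == 0 then cos a else sin a)%:C.
Proof.
have e1 : lift ord0 ord0 = 1 :> 'I_2 by apply: val_inj.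
rewrite mxE mxE big_ord_recl big_ord1 !mxE !big_ord1 !mxE /= e1.
rewrite /proj_dir /pairing /= !rmorphM /=; ring.
Qed.

Section Solution.
Variables (z : R[i]) (w : R -> 'M[R[i]]_2).
Hypothesis hw : fundamental_solution H L z w.

Definition sol_row (i : 'I_2) t : R[i] * R[i] := (w t i 0, w t i 1).

(** Reads the two entries of a row off the equation [w' J = z w H] inside the
    interval between two nodes, where [H] has rank one. *)
Lemma row_derivative n i :
  {ae mu, forall t, node l n < t < node l n.+1 ->
    is_cderive (fun s => w s i 0) t
      (- (z * proj_dir (phi n.+1) (sol_row i t) * (sin (phi n.+1))%:C)) /\
    is_cderive (fun s => w s i 1) t
      (z * proj_dir (phi n.+1) (sol_row i t) * (cos (phi n.+1))%:C)}.
Proof.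
case: hw => _ _; apply: ae_impl => t h /andP[nt tn].
have t0 : 0 < t by apply: le_lt_trans nt; rewrite -(node0 l) node_nondecreasing.
have tL : t \in `[0, L] by rewrite in_itv /= (ltW t0) (le_trans (ltW tn)) ?node_le_length.
have Ht : H t = xi (phi n.+1) *m (xi (phi n.+1))^T.
  by case: hH => _ _ _; apply => //=; rewrite (ltW nt).
have := h tL i 1; have := h tL i 0; rewrite Ht !mul_rank_one /= -/(sol_row i t).
have -> : (fun s => (w s *m matJ) i 0) = (fun s => w s i 1).
  by apply/funext => s; rewrite mul_matJ.
have -> : (fun s => (w s *m matJ) i 1) = (fun s => - w s i 0).
  by apply/funext => s; rewrite mul_matJ.
move=> h0 h1; split => //.
have := @is_cderive_lin _ _ t _ _ (-1) 0 h1 h1.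
set v := z * _ * _.
have -> : v * (-1)%:C + v * 0%:C = - v by rewrite mulr0 addr0 rmorphN1 mulrN1.
congr is_cderive; apply/funext => s.
by rewrite mulr0 addr0 rmorphN1 mulrN1 opprK.
Qed.

(** The derivative of [w xi] is a multiple of [xi^T J xi = 0]; consequently the
    derivative of the whole row is constant between two nodes. *)
Lemma proj_dir_const n i t : node l n <= t <= node l n.+1 ->
  proj_dir (phi n.+1) (sol_row i t) = proj_dir (phi n.+1) (sol_row i (node l n)).
Proof.
move=> /andP[nt tn].
have := @complex_ac_const_derive (fun s => proj_dir (phi n.+1) (sol_row i s)) (node l n) t 0 nt.
rewrite mul0r addr0; apply.
  rewrite /proj_dir /pairing /=; case: hw => ac _ _.
  apply: abs_continuous_lin.
    apply: abs_continuousW (ac i 0); first by rewrite -(node0 l) node_nondecreasing.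
    by rewrite (le_trans tn) ?node_le_length.
  apply: abs_continuousW (ac i 1); first by rewrite -(node0 l) node_nondecreasing.
  by rewrite (le_trans tn) ?node_le_length.
apply: ae_impl (row_derivative n i) => s h /andP[ns st].
have [h0 h1] := h ltac:(by rewrite ns (lt_le_trans st tn)).
have := is_cderive_lin (cos (phi n.+1)) (sin (phi n.+1)) h0 h1.
by congr is_cderive; ring.
Qed.

Lemma sol_row_node n i :
  sol_row i (node l n) = row_traj z l phi (1%:M i 0, 1%:M i 1) n.
Proof.
elim: n => [|n IH]; first by case: hw => _ w0 _; rewrite node0 /sol_row w0.
rewrite /= -IH; set p := proj_dir (phi n.+1) (sol_row i (node l n)).
have nn : node l n <= node l n.+1 by rewrite node_nondecreasing.
have [ac _ _] := hw.
have acn j : abs_continuous (node l n) (node l n.+1) (fun s => w s i j).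
  apply: abs_continuousW (ac i j); first by rewrite -(node0 l) node_nondecreasing.
  exact: node_le_length.
have ln : node l n.+1 - node l n = l n.+1 by rewrite nodeS addrC addKr.
have E0 := @complex_ac_const_derive _ _ _ (- (z * p * (sin (phi n.+1))%:C)) nn (acn 0).
have E1 := @complex_ac_const_derive _ _ _ (z * p * (cos (phi n.+1))%:C) nn (acn 1).
rewrite /row_step /sol_row E0 ?E1 ?ln /=.
- by congr pair; rewrite -/(sol_row i (node l n)) -/p; ring.
- apply: ae_impl (row_derivative n i) => s h hs.
  by have [_] := h hs; rewrite proj_dir_const //; case/andP: hs => /ltW -> /ltW ->.
- apply: ae_impl (row_derivative n i) => s h hs.
  by have [+ _] := h hs; rewrite proj_dir_const //; case/andP: hs => /ltW -> /ltW ->.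
Qed.

Lemma sol_row_cvg i j e : 0 < e ->
  exists N, forall n, (N <= n)%N -> cmod (w L i j - w (node l n) i j) < e.
Proof.
move=> e0; case: hw => /(_ i j e e0)[d d0 h] _ _.
case: hH => _ cv _ _.
have /cvgrPdist_lt/(_ d d0)[N _ hN] : node l n @[n --> \oo] --> L by exact: cv.
exists N => n /hN /=; rewrite ger0_norm ?subr_ge0 ?node_le_length // => dn.
have := h 1%N (fun=> node l n) (fun=> L); rewrite !big_ord1; apply => //.
  by move=> k _; split; [rewrite -(node0 l) node_nondecreasing|rewrite node_le_length].
by move=> k k' /=; case: k => // ; case: k'.
Qed.

End Solution.
End Hamburger.

End Monodromy.

(** * Uniformity in regular variation *)

Section RegularVariation.
Variable R : realType.
Implicit Types (a b : R -> R).
Local Notation mu := (@lebesgue_measure R).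

(** The shifted measure agrees with the Lebesgue measure on intervals, hence on all
    measurable sets by uniqueness. *)
Lemma lebesgue_measure_shift (c : R) (A : set R) : measurable A ->
  mu [set x | A (x - c)] = mu A.
Proof.
move=> mA.
have msh : measurable_fun setT (fun x : measurableTypeR R => x - c : measurableTypeR R).
  exact: measurable_funB.
suff : pushforward mu (fun x : measurableTypeR R => x - c : measurableTypeR R) A = mu A by [].
apply/esym/lebesgue_measure_unique => //= _ [[x y]] _ <- /=.
rewrite /pushforward.
have -> : (fun z : measurableTypeR R => z - c) @^-1` `]x, y]%classic = `]x + c, y + c]%classic.
  by apply/seteqP; split => z /=; rewrite !in_itv /= ltrBrDr lerBlDr.
rewrite !lebesgue_measure_itv /= !lte_fin ltrD2r.
by case: ifP => // _; rewrite -!EFinB; congr EFin; ring.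
Qed.

Lemma measurable_shift (c : R) (A : set R) : measurable A -> measurable [set x | A (x - c)].
Proof.
move=> mA; have : measurable_fun setT (fun x : R => x - c) by exact: measurable_funB.
by move=> /(_ measurableT A mA); rewrite setTI.
Qed.

(** Otherwise the union would have measure above 3, the length of the interval. *)
Lemma overlap_of_large (V W : set R) :
  measurable V -> measurable W -> V `<=` `[0, 3]%classic -> W `<=` `[0, 3]%classic ->
  ((3 / 2)%:E < mu V)%E -> ((3 / 2)%:E < mu W)%E -> exists x, V x /\ W x.
Proof.
move=> mV mW sV sW hV hW; apply: contrapT => nex.
have dis : V `&` W = set0.
  by apply/seteqP; split=> x //= [Vx Wx]; apply: nex; exists x.
have : (mu (V `|` W) <= mu `[0%R, 3%R]%classic)%E.
  apply: le_measure; rewrite ?inE //; first exact: measurableU.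
  by rewrite subUset.
rewrite measureU // [X in (_ <= X)%E](lebesgue_measure_itv `[0%R, 3%R]) /= lte_fin ltr0n /=.
rewrite oppr0 adde0; apply/negP; rewrite -ltNge.
have -> : (3%:E = (3 / 2)%:E + (3 / 2)%:E :> \bar R)%E by rewrite -EFinD; congr EFin; lra.
exact: lteD.
Qed.

(** Continuity of the measure from below. *)
Lemma large_of_exhaust (V : nat -> set R) :
  (forall n, measurable (V n)) -> (forall m n, (m <= n)%N -> V m `<=` V n) ->
  (forall v, 0 <= v <= 2 -> exists n, V n v) ->
  exists n, forall m, (n <= m)%N -> ((3 / 2)%:E < mu (V m `&` `[0%R, 2%R]))%E.
Proof.
move=> mV ndV ex.
pose F n := V n `&` `[0%R, 2%R]%classic.
have mF n : measurable (F n) by apply: measurableI.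
have FU : \bigcup_n F n = `[0%R, 2%R]%classic.
  apply/seteqP; split=> [x [n _ []] //|x x02].
  by have [n Vn] := ex x x02; exists n.
have := @nondecreasing_cvg_mu _ _ _ mu F mF (bigcupT_measurable F mF).
rewrite FU => /(_ _)/wrap[|].
  by move=> m n mn; apply/subsetPset; apply: setSI; exact: ndV.
rewrite [X in _ --> X](lebesgue_measure_itv `[0%R, 2%R]) /= lte_fin ltr0n /= oppr0 adde0.
move=> cv.
have h32 : ((3 / 2)%:E < 2%:E :> \bar R)%E by rewrite lte_fin; lra.
have [n _ hn] := cv _ (open_ereal_gt' h32).
by exists n => m nm; exact: (hn m nm).
Qed.

(** If arbitrarily late increments [g (x_n + u_n) - g x_n] exceeded [2 K], the
    pointwise bounds at the two base points [x_n] and [x_n + u_n] would both hold on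
    sets of measure above 3/2 for large [n]; after translation by [u_n] these sets
    meet, and a common point bounds the increment by [2 K].  Passing to sequences
    makes the sets measurable. *)
Lemma uniform_increment (g : R -> R) (K : R) :
  measurable_fun setT g ->
  (forall v, 0 <= v <= 2 -> exists X, forall x, X <= x -> `|g (x + v) - g x| <= K) ->
  exists X, forall x v, X <= x -> 0 <= v <= 1 -> `|g (x + v) - g x| <= 2 * K.
Proof.
move=> mg hg; apply: contrapT => nex.
have bad (n : nat) : {p : R * R | [/\ n%:R <= p.1, 0 <= p.2 <= 1 &
    2 * K < `|g (p.1 + p.2) - g p.1|]}.
  apply: cid; apply: contrapT => nb; apply: nex; exists n%:R => x v nx v01.
  by rewrite leNgt; apply/negP => lt; apply: nb; exists (x, v).
pose x n := (sval (bad n)).1; pose u n := (sval (bad n)).2.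
have xn n : n%:R <= x n by rewrite /x; case: (bad n) => p [].
have u01 n : 0 <= u n <= 1 by rewrite /u; case: (bad n) => p [].
have gb n : 2 * K < `|g (x n + u n) - g (x n)| by rewrite /x /u; case: (bad n) => p [].
have ge_ex (X : R) : exists n : nat, forall m, (n <= m)%N -> X <= x m.
  exists (Num.truncn X).+1 => m nm; apply: le_trans (xn m).
  apply: le_trans (ltW (truncnS_gt X)) _; by rewrite ler_nat.
pose D (y v : R) := `|g (y + v) - g y| <= K.
have mD y : measurable [set v | D y v].
  have : measurable_fun setT (fun v : R => `|g (y + v) - g y|).
    apply: measurableT_comp => //; apply: measurable_funB => //.
    by apply: measurableT_comp => //; exact: measurable_funD.
  move=> /(_ measurableT `]-oo, K]%classic (measurable_itv _)).
  by rewrite setTI; congr measurable; apply/seteqP; split => v /=; rewrite in_itv.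
have good (y : nat -> R) : (forall m, x m <= y m) ->
    exists n, forall m, (n <= m)%N -> ((3 / 2)%:E < mu ((\bigcap_k [set v | D (y (m + k)%N) v]) `&` `[0%R, 2%R]))%E.
  move=> xy; apply: large_of_exhaust.
  - by move=> n; apply: bigcapT_measurable => k; exact: mD.
  - move=> m n mn v H k _.
    have := H (n - m + k)%N I; by rewrite addnA subnKC.
  - move=> v /hg[X hX]; have [n hn] := ge_ex X.
    exists n => k _; apply: hX; apply: le_trans (xy _); apply: hn; exact: leq_addr.
have [n1 h1] := good x (fun m => lexx _).
have [n2 h2] := good (fun m => x m + u m) (fun m => ltac:(by rewrite lerDl; case/andP: (u01 m))).
pose n := maxn n1 n2.
have {}h1 := h1 n (leq_maxl _ _); have {}h2 := h2 n (leq_maxr _ _).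
set V1 := _ `&` _ in h1; set V2 := _ `&` _ in h2.
have mV1 : measurable V1.
  by apply: measurableI => //; apply: bigcapT_measurable => k; exact: mD.
have mV2 : measurable V2.
  by apply: measurableI => //; apply: bigcapT_measurable => k; exact: mD.
have [u0 u1] := andP (u01 n).
have [v [[V1v /= v02] [V2v /= w02]]] : exists v, V1 v /\ [set z | V2 (z - u n)] v.
  apply: overlap_of_large => //; first exact: measurable_shift.
  - by move=> z [_] /=; rewrite !in_itv /= => /andP[z0 z2]; apply/andP; split; lra.
  - by move=> z [_] /=; rewrite !in_itv /= => /andP[z0 z2]; apply/andP; split; lra.
  - by rewrite lebesgue_measure_shift.
have := V1v 0%N I; have := V2v 0%N I; rewrite /= /D addn0.
have -> : x n + u n + (v - u n) = x n + v by ring.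
move=> k1 k2; have := gb n.
have -> : g (x n + u n) - g (x n) = (g (x n + v) - g (x n)) - (g (x n + v) - g (x n + u n)) by ring.
have := ler_normB (g (x n + v) - g (x n)) (g (x n + v) - g (x n + u n)).
lra.
Qed.

Lemma near_pinfty_ge (P : R -> Prop) :
  (\forall x \near +oo, P x) -> exists X, 1 <= X /\ forall x, X <= x -> P x.
Proof.
move=> [M [_ hM]]; exists (Num.max (M + 1) 1); split; first by rewrite le_max lexx orbT.
move=> x; rewrite ge_max => /andP[h _]; apply: hM; apply: lt_le_trans h.
by rewrite ltrDl.
Qed.

(** On a logarithmic scale regular variation says that the increments of
    [s |-> ln (d (expR s))] over fixed shifts converge, hence are eventually
    bounded; [uniform_increment] makes the bound uniform in the shift. *)
Lemma regularly_varying_doubling d (alpha : R) : regularly_varying d alpha ->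
  exists X C : R, [/\ 1 <= X, 1 <= C & forall x y, X <= x -> x <= y <= 2 * x ->
     d y <= C * d x /\ d x <= C * d y].
Proof.
move=> [md d0 hd].
pose G (s : R) := ln (d (expR s)).
pose g : R -> R := G \_ `[0, +oo[.
have gE s : 0 <= s -> g s = G s.
  by move=> s0; rewrite /g patchE mem_set //= in_itv /= s0.
have mg : measurable_fun setT g.
  apply/(measurable_restrictT _ (measurable_itv _)).
  rewrite (_ : G = @ln R \o (d \o expR)) //.
  apply: measurableT_comp; first exact: measurable_ln.
  pose F : set R := `[1, +oo[%classic.
  apply: (measurable_comp (F := F)) => //; rewrite /F.
  - exact: measurable_itv.
  - move=> _ [s /= + <-]; rewrite !in_itv /= !andbT => s0.
    by apply: le_trans (expR_ge1Dx s); rewrite lerDl.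
  - by apply: measurable_funTS; exact: measurable_expR.
(* The limit of the increment over a shift [v] in [0, 2] is [v * alpha]. *)
pose K : R := 2 * `|alpha| + 1.
have hg v : 0 <= v <= 2 -> exists X, forall x, X <= x -> `|g (x + v) - g x| <= K.
  move=> /andP[v0 v2].
  have e0 := expR_gt0 v.
  have lim := hd _ e0; pose Lm : R := expR (v * alpha).
  have E : expR v `^ alpha = Lm by rewrite /Lm expRM.
  rewrite E in lim.
  have L0 : 0 < Lm by exact: expR_gt0.
  have h2 : Lm / expR 1 < Lm.
    by rewrite ltr_pdivrMr ?expR_gt0 // ltr_pMr // expR_gt1.
  have h3 : Lm < Lm * expR 1 by rewrite ltr_pMr // expR_gt1.
  have [X1 [X11 H1]] := near_pinfty_ge (cvgr_gt _ lim _ h2).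
  have [X2 [X21 H2]] := near_pinfty_ge (cvgr_lt _ lim _ h3).
  exists (Num.max 0 (ln (Num.max X1 X2))) => s; rewrite ge_max => /andP[s0 sX].
  have m0 : 0 < Num.max X1 X2 by rewrite lt_max (lt_le_trans ltr01 X11).
  have sX' : Num.max X1 X2 <= expR s by rewrite -(lnK m0) ler_expR.
  move: sX'; rewrite ge_max => /andP[/H1 k1 /H2 k2].
  rewrite !gE ?addr_ge0 // /G (addrC s) expRD.
  have es1 : 1 <= expR s by apply: le_trans (expR_ge1Dx s); rewrite lerDl.
  have evs1 : 1 <= expR v * expR s.
    by rewrite -expRD; apply: le_trans (expR_ge1Dx _); rewrite lerDl addr_ge0.
  have p1 := d0 _ es1; have p2 := d0 _ evs1.
  have q0 : 0 < d (expR v * expR s) / d (expR s) by rewrite divr_gt0.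
  rewrite -ln_div ?posrE //.
  have q1 : Lm / expR 1 <= d (expR v * expR s) / d (expR s) by exact: ltW.
  have q2 : d (expR v * expR s) / d (expR s) <= Lm * expR 1 by exact: ltW.
  have r1 : v * alpha - 1 <= ln (d (expR v * expR s) / d (expR s)).
    by rewrite -(expRK (v * alpha - 1)) ler_ln ?posrE ?expR_gt0 // expRB.
  have r2 : ln (d (expR v * expR s) / d (expR s)) <= v * alpha + 1.
    by rewrite -(expRK (v * alpha + 1)) ler_ln ?posrE ?expR_gt0 // expRD.
  have r3 : `|v * alpha| <= 2 * `|alpha| by rewrite normrM (ger0_norm v0) ler_wpM2r.
  move: r3; rewrite ler_norml => /andP[r3 r4].
  by rewrite ler_norml /K; apply/andP; split; lra.
have [X HX] := uniform_increment mg hg.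
have K0 : 0 <= 2 * K by rewrite mulr_ge0 // addr_ge0 // mulr_ge0.
exists (expR (Num.max X 0)), (expR (2 * K)); split.
- by apply: le_trans (expR_ge1Dx _); rewrite lerDl le_max lexx orbT.
- by apply: le_trans (expR_ge1Dx _); rewrite lerDl.
move=> x y xX /andP[xy yx].
have x0 : 0 < x by apply: lt_le_trans xX; exact: expR_gt0.
have y0 : 0 < y by apply: lt_le_trans xy.
have sX : Num.max X 0 <= ln x by rewrite -(expRK (Num.max X 0)) ler_ln ?posrE ?expR_gt0.
move: sX; rewrite ge_max => /andP[sX s0].
have v0 : 0 <= ln (y / x) by rewrite ln_ge0 // ler_pdivlMr // mul1r.
have v1 : ln (y / x) <= 1.
  rewrite -(expRK 1) ler_ln ?posrE ?expR_gt0 ?divr_gt0 //.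
  by rewrite ler_pdivrMr //; have := expR_ge1Dx (1 : R); nra.
have := HX (ln x) (ln (y / x)) sX; rewrite v0 v1 => /(_ isT).
rewrite !gE ?addr_ge0 // /G ln_div ?posrE // addrCA subrr addr0 !lnK ?posrE //.
have x1 : 1 <= x.
  by rewrite -(lnK x0); apply: le_trans (expR_ge1Dx _); rewrite lerDl.
have dx := d0 _ x1; have dy := d0 _ (le_trans x1 xy).
rewrite ler_norml => /andP[h1 h2].
split.
  by rewrite -ler_ln ?posrE ?mulr_gt0 ?expR_gt0 // lnM ?posrE ?expR_gt0 // expRK; lra.
by rewrite -ler_ln ?posrE ?mulr_gt0 ?expR_gt0 // lnM ?posrE ?expR_gt0 // expRK; lra.
Qed.

Lemma dyadic_straddle (t : R) : 1 <= t -> exists n : nat, 2 ^+ n <= t <= 2 * 2 ^+ n.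
Proof.
move=> t1.
have ex : exists n : nat, t <= 2 * 2 ^+ n.
  exists (Num.bound t); apply: le_trans (_ : 2 ^+ Num.bound t <= _).
    by apply: ltW; exact: upper_nthrootP.
  by rewrite ler_peMl ?exprn_ge0 // ler1n.
case: (ex_minnP ex) => -[|n] hn min.
  by exists 0%N; rewrite expr0 t1 -(expr0 2).
exists n.+1; rewrite hn andbT leNgt; apply/negP => lt.
have : t <= 2 * 2 ^+ n by rewrite -exprS; exact: ltW.
by move/min; rewrite ltnn.
Qed.

(** Iterates the bound for [b (2 x) / b x] and fills in the last dyadic interval
    with the doubling bound.  Stated for a bare function because it is applied to
    a regularly varying function and to its reciprocal. *)
Lemma doubling_growth (b : R -> R) (X C beta : R) : 1 <= X -> 0 <= C ->
  (forall x, X <= x -> 0 < b x) ->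
  (forall x y, X <= x -> x <= y <= 2 * x -> b y <= C * b x) ->
  (forall x, X <= x -> b (2 * x) <= 2 `^ beta * b x) ->
  forall x y, X <= x -> x <= y ->
    b y <= C * 2 `^ `|beta| * (y / x) `^ beta * b x.
Proof.
move=> X1 C0 b0 hC h2 x y Xx xy.
have x0 : 0 < x by apply: lt_le_trans Xx; apply: lt_le_trans X1.
have t1 : 1 <= y / x by rewrite ler_pdivlMr // mul1r.
have [n /andP[n1 n2]] := dyadic_straddle t1.
have p1 k : 1 <= 2 ^+ k :> R by rewrite exprn_ege1 // ler1n.
have xk k : X <= 2 ^+ k * x.
  by apply: le_trans Xx _; rewrite ler_peMl // ltW.
have iter k : b (2 ^+ k * x) <= (2 `^ beta) ^+ k * b x.
  elim: k => [|k IH]; first by rewrite !expr0 !mul1r.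
  rewrite exprS -mulrA; apply: le_trans (h2 _ (xk k)) _.
  by rewrite exprS -mulrA ler_wpM2l ?powR_ge0.
have hy : b y <= C * b (2 ^+ n * x).
  apply: hC => //; rewrite -ler_pdivlMr // n1 /=.
  by rewrite mulrA -ler_pdivrMr.
apply: le_trans hy _; rewrite -!mulrA ler_wpM2l //.
apply: le_trans (iter n) _; rewrite mulrA ler_wpM2r ?(ltW (b0 _ Xx)) //.
have tp : 0 < y / x by apply: lt_le_trans t1.
have q0 : 0 < 2 ^+ n :> R by apply: lt_le_trans (p1 n).
rewrite -powR_mulrn ?powR_ge0 // -powRrM mulrC powRrM powR_mulrn //.
rewrite -ler_ln ?posrE ?mulr_gt0 ?powR_gt0 // lnM ?posrE ?powR_gt0 // !ln_powR.
have l1 : ln (2 ^+ n) <= ln (y / x) by rewrite ler_ln ?posrE.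
have l2 : ln (y / x) <= ln 2 + ln (2 ^+ n :> R).
  by rewrite -lnM ?posrE // ler_ln ?posrE // mulr_gt0.
rewrite -lerBlDr -mulrBr; apply: le_trans (ler_norm _) _; rewrite normrM.
by rewrite ler_wpM2l // ler_norml; apply/andP; split; lra.
Qed.

(** Potter bounds, with a multiplicative constant. *)
Lemma regularly_varying_potter d (alpha eps : R) : regularly_varying d alpha ->
  0 < eps -> exists X C : R, [/\ 1 <= X, 1 <= C & forall x y, X <= x -> x <= y ->
     d y <= C * (y / x) `^ (alpha + eps) * d x /\
     (y / x) `^ (alpha - eps) * d x <= C * d y].
Proof.
move=> rv eps0; have [X0 [C0 [X01 C01 hX0]]] := regularly_varying_doubling rv.
case: rv => _ d0 hd.
have lim := hd 2 ltac:(by []).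
have pow_lt (x y : R) : x < y -> 2 `^ x < 2 `^ y :> R.
  by move=> xy; rewrite /powR pnatr_eq0 /= ltr_expR ltr_pM2r // ln_gt0 // ltr1n.
have h1 : 2 `^ alpha < 2 `^ (alpha + eps) :> R by apply: pow_lt; rewrite ltrDl.
have h2 : 2 `^ (alpha - eps) < 2 `^ alpha :> R by apply: pow_lt; rewrite gtrBl.
have [X1 [X11 H1]] := near_pinfty_ge (cvgr_lt _ lim _ h1).
have [X2 [X21 H2]] := near_pinfty_ge (cvgr_gt _ lim _ h2).
pose X := Num.max X0 (Num.max X1 X2).
have XX0 : X0 <= X by rewrite /X le_max lexx.
have XX1 : X1 <= X by rewrite /X !le_max lexx orbT.
have XX2 : X2 <= X by rewrite /X !le_max lexx !orbT.
have X1' : 1 <= X by exact: le_trans XX0.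
have dX x : X <= x -> 0 < d x by move=> Xx; apply: d0; exact: le_trans Xx.
have x2x x : X <= x -> x <= 2 * x.
  by move=> Xx; rewrite ler_peMl ?ler1n // (le_trans _ Xx) // (le_trans _ X1').
have U := @doubling_growth d X C0 (alpha + eps) X1' (le_trans ler01 C01) dX.
have Lo := @doubling_growth (fun x => (d x)^-1) X C0 (eps - alpha) X1' (le_trans ler01 C01).
have dX' x : X <= x -> 0 < (d x)^-1 by move=> /dX; rewrite invr_gt0.
have {}U x y : X <= x -> x <= y ->
    d y <= C0 * 2 `^ `|alpha + eps| * (y / x) `^ (alpha + eps) * d x.
  apply: U => [x' y' Xx' h|x' Xx'].
    by have [] := hX0 x' y' (le_trans XX0 Xx') h.
  rewrite -ler_pdivrMr ?dX //; apply: ltW; apply: H1; exact: le_trans Xx'.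
have {}Lo x y : X <= x -> x <= y ->
    (d y)^-1 <= C0 * 2 `^ `|eps - alpha| * (y / x) `^ (eps - alpha) * (d x)^-1.
  apply: (Lo dX') => [x' y' Xx' h|x' Xx'].
    have [_ k] := hX0 x' y' (le_trans XX0 Xx') h.
    have dx' := dX _ Xx'; have dy' : 0 < d y' by apply: dX; case/andP: h => /(le_trans Xx').
    by rewrite ler_pdivlMr // mulrC ler_pdivrMr.
  have k : 2 `^ (alpha - eps) <= d (2 * x') / d x'.
    by apply: ltW; apply: H2; exact: le_trans Xx'.
  have dx' := dX _ Xx'; have d2x' : 0 < d (2 * x').
    by apply: dX; apply: le_trans Xx' (x2x _ Xx').
  rewrite -opprB powRN -invfM lef_pV2 ?posrE ?mulr_gt0 ?powR_gt0 //.
  by rewrite -ler_pdivlMr.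
pose C := Num.max (C0 * 2 `^ `|alpha + eps|) (C0 * 2 `^ `|eps - alpha|).
have CA : C0 * 2 `^ `|alpha + eps| <= C by rewrite le_max lexx.
have CB : C0 * 2 `^ `|eps - alpha| <= C by rewrite le_max lexx orbT.
exists X, C; split=> //.
  apply: le_trans CA; apply: (le_trans C01); rewrite ler_peMr //.
    exact: le_trans C01.
  apply: (@le_trans _ _ (2 `^ 0)); first by rewrite powRr0.
  by apply: ler_powR; rewrite ?ler1n ?normr_ge0.
move=> x y Xx xy; have dx := dX _ Xx; have dy := dX _ (le_trans Xx xy).
split.
  apply: le_trans (U x y Xx xy) _; rewrite !ler_wpM2r ?powR_ge0 ?(ltW dx) //.
have := Lo x y Xx xy; rewrite -opprB powRN.
have p0 : 0 < (y / x) `^ (alpha - eps).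
  have x0 : 0 < x by apply: lt_le_trans Xx; apply: lt_le_trans X1'.
  by rewrite powR_gt0 // divr_gt0 // (lt_le_trans x0).
move: p0; set p := _ `^ (alpha - eps) => p0 k.
have {}k : (d y)^-1 <= C / (p * d x).
  apply: le_trans k _; rewrite invfM mulrA.
  have i1 : 0 <= p^-1 by rewrite invr_ge0 ltW.
  have i2 : 0 <= (d x)^-1 by rewrite invr_ge0 ltW.
  by rewrite normrN distrC ler_wpM2r // ler_wpM2r.
by move: k; rewrite ler_pdivlMr ?mulr_gt0 // mulrC ler_pdivrMr.
Qed.

End RegularVariation.

(** * Power bounds for regularly varying functions *)

Section PowerBounds.
Variable R : realType.
Implicit Types (d : R -> R).

Lemma powR_large (g K : R) : 0 < g -> exists2 Y : R, 1 <= Y &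
  forall y, Y <= y -> K <= y `^ g.
Proof.
move=> g0; pose K' := Num.max K 1.
have K1 : 1 <= K' by rewrite le_max lexx orbT.
have K0 : 0 < K' by apply: lt_le_trans K1.
exists (expR (ln K' / g)).
  by rewrite -expR0 ler_expR divr_ge0 ?ln_ge0 // ltW.
move=> y Yy; have y0 : 0 < y by apply: lt_le_trans Yy; exact: expR_gt0.
apply: (@le_trans _ _ K'); first by rewrite le_max lexx.
rewrite -ler_ln ?posrE ?powR_gt0 // ln_powR mulrC -ler_pdivrMr //.
by rewrite -(expRK (ln K' / g)) ler_ln ?posrE ?expR_gt0.
Qed.

(** [regularly_varying_potter] with the smaller argument fixed. *)
Lemma regularly_varying_powers d (alpha eps : R) : regularly_varying d alpha ->
  0 < eps -> exists X c C : R, [/\ 1 <= X, 0 < c, 0 < C & forall y, X <= y ->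
    c * y `^ (alpha - eps) <= d y /\ d y <= C * y `^ (alpha + eps)].
Proof.
move=> rv eps0; have [X [C [X1 C1 h]]] := regularly_varying_potter rv eps0.
have [_ d0 _] := rv; have dX := d0 _ X1.
have X0 : 0 < X by apply: lt_le_trans X1.
have C0 : 0 < C by apply: lt_le_trans C1.
exists X, (d X / (C * X `^ (alpha - eps))), (C * d X / X `^ (alpha + eps)); split => //.
- by rewrite divr_gt0 // mulr_gt0 // powR_gt0.
- by rewrite divr_gt0 ?powR_gt0 // mulr_gt0.
move=> y Xy; have y0 : 0 < y by apply: lt_le_trans Xy.
have [h1 h2] := h X y (lexx _) Xy.
have pE b : (y / X) `^ b = y `^ b / X `^ b.
  rewrite powRM ?invr_ge0 ?(ltW y0) ?(ltW X0) //; congr (_ * _).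
  by rewrite -powR_inv1 ?(ltW X0) // -powRrM mulN1r powRN.
rewrite !pE in h1 h2; split.
  rewrite -(ler_pM2l C0); apply: le_trans h2.
  rewrite le_eqVlt; apply/orP; left; apply/eqP; field.
  by rewrite !gt_eqF ?powR_gt0.
apply: (le_trans h1); rewrite le_eqVlt; apply/orP; left; apply/eqP; field.
by rewrite !gt_eqF ?powR_gt0.
Qed.

Lemma regularly_varying_small d (delta e : R) : regularly_varying d (- delta) ->
  0 < delta -> 0 < e -> exists2 Y, 1 <= Y & forall y, Y <= y -> d y <= e.
Proof.
move=> rv delta0 e0.
have [|X [c [C [X1 c0 C0 h]]]] := regularly_varying_powers rv (eps := delta / 2).
  by rewrite divr_gt0.
have [|Y Y1 hY] := @powR_large (delta / 2) (C / e); first by rewrite divr_gt0.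
exists (Num.max X Y); first by rewrite le_max X1.
move=> y; rewrite ge_max => /andP[/h[_ h2] Yy].
apply: (le_trans h2).
have -> : - delta + delta / 2 = - (delta / 2) by lra.
have y0 : 0 < y by apply: lt_le_trans Yy; apply: lt_le_trans Y1.
rewrite powRN ler_pdivrMr ?powR_gt0 // mulrC -ler_pdivrMr //; exact: hY.
Qed.

Lemma regularly_varying_times_large d (delta K : R) : regularly_varying d (- delta) ->
  delta < 1 -> exists2 Y, 1 <= Y & forall y, Y <= y -> K <= y * d y.
Proof.
move=> rv delta1.
have [|X [c [C [X1 c0 C0 h]]]] := regularly_varying_powers rv (eps := (1 - delta) / 2).
  by rewrite divr_gt0 // subr_gt0.
have [|Y Y1 hY] := @powR_large ((1 - delta) / 2) (K / c).
  by rewrite divr_gt0 // subr_gt0.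
exists (Num.max X Y); first by rewrite le_max X1.
move=> y; rewrite ge_max => /andP[/h[h1 _] Yy].
have y0 : 0 < y by apply: lt_le_trans Yy; apply: lt_le_trans Y1.
apply: le_trans (_ : y * (c * y `^ (- delta - (1 - delta) / 2)) <= _); last first.
  by rewrite ler_wpM2l // ltW.
rewrite mulrCA -{1}(powRr1 (ltW y0)) -powRD ?(gt_eqF y0) ?implybT //.
rewrite mulrC -ler_pdivrMr //.
have -> : 1 + (- delta - (1 - delta) / 2) = (1 - delta) / 2 by lra.
exact: hY.
Qed.

Lemma regularly_varying_ratio d d' (delta delta' eps : R) :
  regularly_varying d (- delta) -> regularly_varying d' (- delta') -> 0 < eps ->
  exists X c C : R, [/\ 1 <= X, 0 < c, 0 < C & forall y, X <= y ->
    c * y `^ (delta' - delta - 2 * eps) <= d y / d' y /\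
    d y / d' y <= C * y `^ (delta' - delta + 2 * eps)].
Proof.
move=> rv rv' eps0; have [_ d0 _] := rv; have [_ d0' _] := rv'.
have [X [c [C [X1 c0 C0 h]]]] := regularly_varying_powers rv eps0.
have [X' [c' [C' [X1' c0' C0' h']]]] := regularly_varying_powers rv' eps0.
exists (Num.max X X'), (c / C'), (C / c'); split; rewrite ?le_max ?X1 ?divr_gt0 //.
move=> y; rewrite ge_max => /andP[Xy Xy'].
have [h1 h2] := h _ Xy; have [h3 h4] := h' _ Xy'.
have y1 : 1 <= y by apply: le_trans Xy.
have y0 : 0 < y by apply: lt_le_trans y1.
have dy := d0 _ y1; have dy' := d0' _ y1.
have pB a b : y `^ (a - b) = y `^ a / y `^ b.
  by rewrite powRB // (gt_eqF y0) implybT.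
split.
  rewrite ler_pdivlMr //; apply: le_trans h1.
  rewrite (_ : delta' - delta - 2 * eps = (- delta - eps) - (- delta' + eps)); last by ring.
  rewrite (pB (- delta - eps) (- delta' + eps)).
  apply: (@le_trans _ _ (c / C' * (y `^ (- delta - eps) / y `^ (- delta' + eps)) * (C' * y `^ (- delta' + eps)))).
    rewrite ler_wpM2l // mulr_ge0 ?divr_ge0 ?powR_ge0 ?(ltW c0) ?(ltW C0') //.
  rewrite le_eqVlt; apply/orP; left; apply/eqP; field.
  by rewrite !gt_eqF ?powR_gt0.
rewrite ler_pdivrMr //; apply: (le_trans h2).
rewrite (_ : delta' - delta + 2 * eps = (- delta + eps) - (- delta' - eps)); last by ring.
rewrite (pB (- delta + eps) (- delta' - eps)).
apply: (@le_trans _ _ (C / c' * (y `^ (- delta + eps) / y `^ (- delta' - eps)) * (c' * y `^ (- delta' - eps)))).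
  rewrite le_eqVlt; apply/orP; left; apply/eqP; field.
  by rewrite !gt_eqF ?powR_gt0.
rewrite ler_wpM2l // mulr_ge0 ?divr_ge0 ?powR_ge0 ?(ltW c0') ?(ltW C0) //.
Qed.

Lemma nat_above (X : R) : exists N : nat, forall n, (N <= n)%N -> X <= n%:R.
Proof.
exists (Num.truncn X).+1 => n nm; apply: le_trans (ltW (truncnS_gt X)) _.
by rewrite ler_nat.
Qed.

(** If the index were above -1, the function would dominate a multiple of the
    harmonic series. *)
Lemma index_ge1_of_bounded_sums d (delta : R) (l : nat -> R) C L (N0 : nat) :
  regularly_varying d (- delta) ->
  (forall j, (1 <= j)%N -> 0 <= l j) ->
  (forall j, (N0 <= j)%N -> d j%:R <= C * l j) ->
  0 < C -> (forall n, node l n <= L) -> 1 <= delta.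
Proof.
move=> rv l0 dl C0 lL; rewrite leNgt; apply/negP => delta1.
have [|X [c [C' [X1 c0 C0' h]]]] := regularly_varying_powers rv (eps := 1 - delta).
  by rewrite subr_gt0.
have [N1 hN1] := nat_above X.
pose N := maxn N0 N1.
apply: (@dvg_harmonic R).
apply: nondecreasing_is_cvgn.
  by apply/nondecreasing_series => n _ _; exact: harmonic_ge0.
pose A := \sum_(0 <= j < N) (harmonic j : R).
exists (A + C / c * L) => _ [n _ <-]; rewrite /series /=.
have cN j : (N <= j)%N -> harmonic j <= C / c * l j.+1 :> R.
  move=> Nj; have [h1 _] := h j.+1%:R (hN1 j.+1 ltac:(nat_lia)).
  have : - delta - (1 - delta) = -1 by ring.
  move=> E; rewrite E powR_inv1 // in h1.
  have := le_trans h1 (dl j.+1 ltac:(nat_lia)).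
  rewrite /harmonic mulrAC ler_pdivlMr // mulrC //.
have CL : 0 <= C / c * L.
  by rewrite mulr_ge0 ?divr_ge0 ?(ltW C0) ?(ltW c0) //; rewrite -(node0 l).
have [nN|Nn] := leqP n N.
  apply: (@le_trans _ _ A); last by rewrite lerDl.
  rewrite /A [leRHS](big_cat_nat _ (n := n)) //= lerDl sumr_ge0 //.
rewrite (big_cat_nat _ (n := N)) //=; last exact: ltnW.
rewrite lerD2l; apply: (@le_trans _ _ (\sum_(N <= j < n) C / c * l j.+1)).
  rewrite [leLHS]big_nat_cond [leRHS]big_nat_cond.
  by apply: ler_sum => j /andP[/andP[Nj _] _]; exact: cN.
rewrite -mulr_sumr ler_wpM2l ?divr_ge0 ?(ltW C0) ?(ltW c0) //.
apply: le_trans (lL n); rewrite /node big_add1 /= [leRHS](big_cat_nat _ (n := N)) //=; last exact: ltnW.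
by rewrite lerDr sumr_ge0 // => j _; exact: l0.
Qed.

End PowerBounds.

(** * Averaging over blocks of bounded rotation *)

Section Blocks.
Variable R : realType.
Implicit Types (l phi D F : nat -> R) (r c C : R).

Lemma monotone_dist phi N i k : (N <= i)%N ->
  (forall m n, (N <= m)%N -> (m <= n)%N -> phi m <= phi n) \/
  (forall m n, (N <= m)%N -> (m <= n)%N -> phi n <= phi m) ->
  `|phi (i + k)%N - phi i| = \sum_(0 <= j < k) `|phi (i + j).+1 - phi (i + j)%N|.
Proof.
move=> Ni mon; elim: k => [|k IH]; first by rewrite addn0 subrr normr0 big_geq.
rewrite big_nat_recr //= -IH addnS; case: mon => mon.
  have h1 : phi i <= phi (i + k)%N by apply: mon => //; rewrite leq_addr.
  have h2 : phi (i + k)%N <= phi (i + k).+1 by apply: mon => //; lia.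
  by rewrite !ger0_norm ?subr_ge0 ?(le_trans h1) //; ring.
have h1 : phi (i + k)%N <= phi i by apply: mon => //; rewrite leq_addr.
have h2 : phi (i + k).+1 <= phi (i + k)%N by apply: mon => //; lia.
by rewrite !ler0_norm ?subr_le0 ?(le_trans h2) //; ring.
Qed.

Lemma sin_abs_lower (s0 x : R) : 0 < s0 -> s0 <= `|x| -> `|x| <= 1 ->
  sin s0 ^+ 2 <= sin x ^+ 2.
Proof.
move=> s00 sx x1.
have pi2 : 1 <= pi / 2 :> R by have := pi_ge2 R; lra.
have -> : sin x ^+ 2 = sin `|x| ^+ 2.
  by case: (ger0P x) => // _; rewrite sinN sqrrN.
have s1 : s0 <= 1 by exact: le_trans x1.
rewrite ler_sqr ?nnegrE ?sin_ge0_pi //.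
- rewrite le_eqVlt; move: sx; rewrite le_eqVlt => /orP[/eqP ->|lt]; first by rewrite eqxx.
  by rewrite ltr_sin ?lt ?orbT // in_itv /=; apply/andP; split; lra.
- by apply/andP; split; lra.
- by apply/andP; split; lra.
Qed.

Lemma expR_half_le (y : R) : 0 <= y <= 1 -> expR (y / 2) <= 1 + y.
Proof.
move=> /andP[y0 y1].
have h := expR_ge1Dx (- (y / 2)).
have p0 : 0 < 1 + - (y / 2) by lra.
have e0 := expR_gt0 (y / 2).
have : expR (y / 2) * (1 - y / 2) <= 1.
  by rewrite -[leRHS](expRxMexpNx_1 (y / 2)) ler_wpM2l ?(ltW e0).
nra.
Qed.

(** [D] and [F] stand for the values of [d_l] and [d_phi] at the integers, and [l] for
    the decreased lengths; the constant [C] serves all the comparisons. *)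
Section Averaging.
Variables (l phi D F : nat -> R) (N : nat) (C : R).
Hypotheses (C1 : 1 <= C) (N1 : (1 <= N)%N)
  (l0 : forall j, (1 <= j)%N -> 0 <= l j)
  (lD : forall j, (N < j)%N -> l j = D j / C)
  (D0 : forall j, (N <= j)%N -> 0 < D j)
  (F0 : forall j, (N <= j)%N -> 0 < F j)
  (Dcomp : forall n j, (N <= n)%N -> (n <= j <= 2 * n)%N -> D j <= C * D n /\ D n <= C * D j)
  (Fcomp : forall n j, (N <= n)%N -> (n <= j <= 2 * n)%N -> F j <= C * F n /\ F n <= C * F j)
  (Fphi : forall n, (N <= n)%N ->
     `|phi n.+1 - phi n| <= C * F n /\ F n <= C * `|phi n.+1 - phi n|)
  (mon : (forall m n, (N <= m)%N -> (m <= n)%N -> phi m <= phi n) \/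
         (forall m n, (N <= m)%N -> (m <= n)%N -> phi n <= phi m))
  (Fsmall : forall n, (N <= n)%N -> C ^+ 2 * F n <= 1)
  (Flarge : forall n, (N <= n)%N -> 2 <= n%:R * F n).

Let s0 : R := (2 * C ^+ 4)^-1.

(** [s0] bounds from below the angle by which half a block turns, as follows from
    the choice of the block in [block_gain]. *)
Definition gain_rate : R := sin s0 ^+ 2 / (40 * C ^+ 3).

Let C0 : 0 < C. Proof. exact: lt_le_trans C1. Qed.

Let s00 : 0 < s0. Proof. by rewrite invr_gt0 mulr_gt0 // exprn_gt0. Qed.

Let s01 : s0 <= 1.
Proof. by rewrite invf_le1 ?mulr_gt0 ?exprn_gt0 // mulr_ege1 ?exprn_ege1 // ler1n. Qed.

Lemma gain_rate_gt0 : 0 < gain_rate.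
Proof.
apply: divr_gt0; last by rewrite mulr_gt0 ?exprn_gt0.
rewrite exprn_gt0 // sin_gt0_pi // s00 /=.
by apply: le_lt_trans s01 _; have := pi_ge2 R; lra.
Qed.

(** The block consists of [2 m] steps with [m] the integer part of
    [1 / (C ^+ 2 * F n)]: then half a block turns by an angle in [[s0, 1]], and [r]
    times the length of the block is at most 2 because [r * D n <= F n].  The factor
    [1 + y] provided by [energy_gain_block] is at least [expR (y / 2)] since
    [y <= 1]. *)
Lemma block_gain r v n : 0 <= r -> (N <= n)%N -> r * D n <= F n ->
  let V := row_traj (0 +i* r) l phi v in 0 <= energy (V n) ->
  exists2 n', (n < n')%N &
    expR (gain_rate * (r * \sum_(n <= j < n') D j.+1)) * energy (V n) <= energy (V n').
Proof.
move=> r0 Nn rDF V Ev.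
pose q := (C ^+ 2 * F n)^-1.
have f0 := F0 Nn; have d0 := D0 Nn.
have q0 : 0 < C ^+ 2 * F n by rewrite mulr_gt0 ?exprn_gt0.
have q1 : 1 <= q by rewrite invf_ge1 ?Fsmall.
have [m [m1 mq qm]] : exists m : nat, [/\ (1 <= m)%N, m%:R <= q & q < m.+1%:R].
  exists (Num.truncn q); have /andP[h1 h2] := truncn_itv (le_trans ler01 q1).
  by split=> //; rewrite truncn_gt0.
have mF1 : m%:R * F n <= (C ^+ 2)^-1.
  rewrite -ler_pdivlMr //; apply: le_trans mq _.
  by rewrite /q invfM mulrC.
have mF2 : (2 * C ^+ 2)^-1 <= m%:R * F n.
  have h : q <= m%:R * 2.
    by apply: le_trans (ltW qm) _; rewrite -natrM ler_nat; clear -m1; nat_lia.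
  have -> : (2 * C ^+ 2)^-1 = q * F n / 2.
    by rewrite /q; field; rewrite !gt_eqF.
  by rewrite ler_pdivrMr // mulrAC ler_wpM2r // ltW.
(* The block stays within [[n, 2 n]], where [D] and [F] are nearly constant. *)
have mn : (m + m <= n)%N.
  rewrite -(ler_nat R) natrD -(ler_pM2r f0) mulrDl.
  have : (C ^+ 2)^-1 <= 1 by rewrite invf_le1 ?exprn_gt0 // exprn_ege1.
  by have := Flarge Nn; lra.
exists (n + (m + m))%N; first by nat_lia.
rewrite /V row_traj_shift -/V.
have in_block j : (n <= j)%N -> (j <= n + (m + m))%N -> (n <= j <= 2 * n)%N by nat_lia.
pose y := sin s0 ^+ 2 / (2 * (1 + 2 ^+ 2)) * (r * (D n / C ^+ 2) * m%:R).
have gain : (1 + y) * energy (V n) <=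
    energy (row_traj (0 +i* r) (fun j => l (n + j)%N) (fun j => phi (n + j)%N) (V n) (m + m)).
  apply: energy_gain_block => //.
  - by move=> j j1; apply: l0; nat_lia.
  - by rewrite divr_ge0 ?exprn_ge0 ?(ltW d0) // ltW.
  - exact: sqr_ge0.
  - move=> j /andP[j1 jm]; rewrite lD; last by nat_lia.
    have [_ h] := Dcomp Nn (in_block (n + j)%N ltac:(nat_lia) ltac:(nat_lia)).
    by rewrite ler_pdivrMr ?exprn_gt0 // expr2 mulrA divfK ?gt_eqF // mulrC.
  - move=> j /andP[j1 jm].
    have inc k : (k < m)%N ->
       `|phi (n + j + k).+1 - phi (n + j + k)%N| <= C ^+ 2 * F n /\
       F n / C ^+ 2 <= `|phi (n + j + k).+1 - phi (n + j + k)%N|.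
      move=> km.
      have [h1 h2] := Fcomp Nn (in_block (n + j + k)%N ltac:(nat_lia) ltac:(nat_lia)).
      have [h3 h4] := @Fphi (n + j + k)%N ltac:(nat_lia).
      split.
        by apply: le_trans h3 _; rewrite expr2 -mulrA ler_wpM2l // ltW.
      rewrite ler_pdivrMr ?exprn_gt0 // mulrC expr2 -mulrA.
      by apply: le_trans h2 _; rewrite ler_wpM2l // ltW.
    have -> : (n + (m + j) = (n + j) + m)%N by nat_lia.
    apply: sin_abs_lower => //; rewrite (monotone_dist (N := N)) //; try nat_lia.
      apply: (@le_trans _ _ (\sum_(0 <= k < m) F n / C ^+ 2)).
        rewrite sumr_const_nat subn0 -mulr_natl.
        rewrite mulrA /s0 ler_pdivlMr ?exprn_gt0 //; apply: le_trans mF2.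
        rewrite le_eqVlt; apply/orP; left; apply/eqP; field; rewrite gt_eqF //.
      rewrite [leLHS]big_nat_cond [leRHS]big_nat_cond.
      by apply: ler_sum => k /andP[/andP[_ km] _]; have [] := inc k km.
    apply: (@le_trans _ _ (\sum_(0 <= k < m) C ^+ 2 * F n)).
      rewrite [leLHS]big_nat_cond [leRHS]big_nat_cond.
      by apply: ler_sum => k /andP[/andP[_ km] _]; have [] := inc k km.
    rewrite sumr_const_nat subn0 -mulr_natl mulrCA -ler_pdivlMl ?exprn_gt0 //.
    by rewrite mulr1.
  - apply: (@le_trans _ _ (r * \sum_(1 <= j < (m + m).+1) D n)).
      rewrite ler_wpM2l // /node [leLHS]big_nat_cond [leRHS]big_nat_cond.
      apply: ler_sum => j /andP[/andP[j1 jm] _]; rewrite lD; last by nat_lia.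
      have [h _] := Dcomp Nn (in_block (n + j)%N ltac:(nat_lia) ltac:(nat_lia)).
      by rewrite ler_pdivrMr // mulrC.
    rewrite sumr_const_nat subn1 /= -[X in r * X]mulr_natl mulrCA natrD.
    apply: le_trans (_ : (m%:R + m%:R) * F n <= _); first by rewrite ler_wpM2l ?addr_ge0.
    have : (C ^+ 2)^-1 <= 1 by rewrite invf_le1 ?exprn_gt0 // exprn_ege1.
    by rewrite mulrDl; lra.
apply: le_trans gain; rewrite ler_wpM2r //.
have mD : r * D n * m%:R <= 1.
  apply: le_trans (_ : F n * m%:R <= _); first by rewrite ler_wpM2r.
  rewrite mulrC; apply: le_trans mF1 _.
  by rewrite invf_le1 ?exprn_gt0 // exprn_ege1.
have sin1 : sin s0 ^+ 2 <= 1 by have := sqr_ge0 (cos s0); have := cos2Dsin2 s0; lra.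
have yE : y = sin s0 ^+ 2 / 10 * ((r * D n * m%:R) / C ^+ 2).
  by rewrite /y; field; rewrite gt_eqF.
have rDm0 : 0 <= r * D n * m%:R / C ^+ 2.
  by rewrite divr_ge0 ?exprn_ge0 ?(ltW C0) // mulr_ge0 // mulr_ge0 // ltW.
have rDm1 : r * D n * m%:R / C ^+ 2 <= 1.
  rewrite ler_pdivrMr ?exprn_gt0 // mul1r; apply: le_trans mD _.
  by rewrite exprn_ege1.
have sin0 : 0 <= sin s0 ^+ 2 by exact: sqr_ge0.
have y01 : 0 <= y <= 1.
  by rewrite yE; apply/andP; split; nra.
apply: le_trans (expR_half_le y01); rewrite ler_expR.
apply: (@le_trans _ _ (gain_rate * (r * \sum_(n <= j < n + (m + m)) C * D n))).
  rewrite ler_wpM2l ?(ltW gain_rate_gt0) // ler_wpM2l //.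
  rewrite [leLHS]big_nat_cond [leRHS]big_nat_cond.
  apply: ler_sum => j /andP[/andP[j1 jm] _].
  by have [h _] := Dcomp Nn (in_block j.+1 ltac:(nat_lia) ltac:(nat_lia)).
rewrite sumr_const_nat addKn -[C * D n *+ _]mulr_natl natrD.
rewrite le_eqVlt; apply/orP; left; apply/eqP.
by rewrite /y /gain_rate; field; rewrite gt_eqF.
Qed.

Lemma iterated_gain r v n M : 0 <= r -> (N <= n)%N ->
  (forall j, (n <= j)%N -> r * D j <= F j) ->
  let V := row_traj (0 +i* r) l phi v in 0 <= energy (V n) -> (n <= M)%N ->
  exists2 n', (M <= n')%N &
    expR (gain_rate * (r * \sum_(n <= j < n') D j.+1)) * energy (V n) <= energy (V n').
Proof.
move=> r0 Nn rDF V En /subnKC <-; elim: (M - n)%N => [|k [n' kn' hn']].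
  by exists n; rewrite ?addn0 // big_geq // !mulr0 expR0 mul1r.
have [lt|ge] := ltnP (n + k) n'; first by exists n' => //; rewrite addnS.
have nn' : (n <= n')%N by apply: leq_trans kn'; rewrite leq_addr.
have En' : 0 <= energy (V n').
  by apply: le_trans hn'; rewrite mulr_ge0 // expR_ge0.
have [n'' lt h] := block_gain r0 (leq_trans Nn nn') (rDF _ nn') En'.
exists n''; first by rewrite addnS; apply: leq_ltn_trans kn' lt.
apply: le_trans h.
rewrite (big_cat_nat _ (n := n')) //=; last exact: ltnW.
rewrite !mulrDr expRD (mulrC (expR _) (expR _)) -mulrA.
by rewrite ler_wpM2l // expR_ge0.
Qed.

(** Transfers the growth of the energy for the decreased lengths [l] to the second
    entry for the original lengths [lo], through [energy_le_snd] and
    [csq_snd_mono]. *)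
Lemma snd_exponential_growth (lo : nat -> R) (L B : R) r n M : 0 <= r -> (N <= n)%N ->
  (forall j, (n <= j)%N -> r * D j <= F j) -> (n <= M)%N ->
  (forall j, (1 <= j)%N -> 0 <= lo j) ->
  (forall j, (1 <= j)%N -> l j <= lo j) ->
  (forall k, node l k <= L) ->
  (forall k, csq (row_traj (0 +i* r) lo phi (unit2 R) k).2 <= B) ->
  expR (gain_rate * (r * \sum_(n <= j < M) D j.+1)) *
    energy (row_traj (0 +i* r) l phi (unit2 R) n) <= r * L * B.
Proof.
move=> r0 Nn rDF nM lo0 llo lL loB.
have En : 0 <= energy (row_traj (0 +i* r) l phi (unit2 R) n).
  by apply: le_trans (energy_traj_nondecreasing _ l0 _ _ r0); rewrite energy_unit2.
have [n' Mn' h] := iterated_gain r0 Nn rDF En nM.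
apply: (@le_trans _ _ (energy (row_traj (0 +i* r) l phi (unit2 R) n'))).
  apply: le_trans h; rewrite ler_wpM2r // ler_expR ler_wpM2l ?(ltW gain_rate_gt0) //.
  rewrite ler_wpM2l // [leRHS](big_cat_nat _ (n := M)) //= lerDl.
  rewrite big_nat_cond sumr_ge0 // => j /andP[/andP[j1 _] _]; apply/ltW/D0; nat_lia.
apply: le_trans (energy_le_snd _ l0 _ r0) _.
apply: ler_pM => //.
- by rewrite mulr_ge0 ?node_ge0.
- exact: csq_ge0.
- by rewrite ler_wpM2l.
- apply: le_trans (loB n'); apply: csq_snd_mono => // j j1.
  by rewrite l0 // llo.
Qed.

End Averaging.

Lemma sin_eq0 (x : R) : sin x = 0 -> exists k : int, x = k%:~R * pi.
Proof.
move=> sx; have p0 := pi_gt0 R.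
exists (Num.floor (x / pi)); set k := Num.floor _.
have /andP[k1 k2] := floor_itv (x / pi); rewrite -/k in k1 k2.
have sinZ (m : int) (y : R) : sin y = 0 -> sin (y + m%:~R * pi) = 0.
  have per (n : nat) (z : R) : (sin z = 0) <-> (sin (z + n%:R * pi) = 0).
    elim: n => [|n IH]; first by rewrite mul0r addr0.
    rewrite -natr1 mulrDl mul1r addrA sinDpi; split => [/IH->|/eqP]; first by rewrite oppr0.
    by rewrite oppr_eq0 => /eqP/IH.
  move=> y0; case: m => n; first exact: (proj1 (per n y)).
  by rewrite NegzE; apply: (proj2 (per n.+1 _)); rewrite mulrNz mulNr subrK.
have : sin (x - k%:~R * pi) = 0.
  by have := sinZ (- k) _ sx; rewrite mulrNz mulNr.
set y := x - _ => sy.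
have y0 : 0 <= y by rewrite subr_ge0 -ler_pdivlMr.
have y1 : y < pi.
  by move: k2; rewrite intrD mulr1z ltr_pdivrMr // mulrDl mul1r addrC -ltrBlDr.
move: y0; rewrite le_eqVlt => /orP[/eqP y0|y0]; first by apply/eqP; rewrite -subr_eq0 -/y -y0.
by have := @sin_gt0_pi _ y; rewrite y0 y1 sy ltxx => /(_ isT).
Qed.

(** The first direction can be orthogonal to the initial row, but then the row does
    not move and the second direction, being different, is not orthogonal to it. *)
Lemma energy_linear_lower l phi : (forall j, (1 <= j)%N -> 0 < l j) ->
  (forall k : int, phi 2%N - phi 1%N != k%:~R * pi) ->
  exists2 c, 0 < c & forall r n, 0 <= r -> (2 <= n)%N ->
    c * r <= energy (row_traj (0 +i* r) l phi (unit2 R) n).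
Proof.
move=> l0 dphi.
have l0' j : (1 <= j)%N -> 0 <= l j by move=> /l0/ltW.
have red c r n : 0 <= r -> (2 <= n)%N ->
    c <= dissipated l phi (0 +i* r) (unit2 R) 2 ->
    c * r <= energy (row_traj (0 +i* r) l phi (unit2 R) n).
  move=> r0 n2 h; rewrite energy_traj energy_unit2 add0r mulrC ler_wpM2l //.
  by apply: le_trans h _; rewrite -(subnKC n2); exact: dissipated_nondecreasing.
have p1 a : proj_dir a (unit2 R) = (sin a)%:C.
  by rewrite /proj_dir /pairing /= mul0r add0r mul1r.
have csqr (x : R) : csq x%:C = x ^+ 2 by rewrite /csq /= expr0n addr0.
have [s1|s1] := eqVneq (sin (phi 1%N)) 0.
  have s2 : sin (phi 2%N) != 0.
    apply/eqP => s2; have [k1 h1] := sin_eq0 s1; have [k2 h2] := sin_eq0 s2.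
    by have /eqP := dphi (k2 - k1); apply; rewrite h1 h2 intrB mulrBl.
  exists (l 2%N * sin (phi 2%N) ^+ 2).
    by rewrite mulr_gt0 ?l0 // exprn_even_gt0.
  move=> r n r0 n2; apply: red => //.
  rewrite !dissipatedS /= /row_step p1 s1 !mulr0 mul0r subr0 addr0 p1 csqr.
  rewrite csqr expr0n /= mulr0 addr0.
  by rewrite lerDr dissipated_ge0.
exists (l 1%N * sin (phi 1%N) ^+ 2).
  by rewrite mulr_gt0 ?l0 // exprn_even_gt0.
move=> r n r0 n2; apply: red => //.
rewrite !dissipatedS /= p1 csqr -addrA -[leLHS]add0r lerD ?dissipated_ge0 //.
by rewrite lerDl mulr_ge0 ?csq_ge0 ?l0'.
Qed.

End Blocks.

(** * Exponential growth of the lower right entry *)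

Section Growth.
Variables (R : realType) (H : R -> 'M[R]_2) (l phi : nat -> R)
  (W : R -> R[i] -> 'M[R[i]]_2) (dl dphi : R -> R) (delta_l delta_phi : R).
Hypotheses (hH : hamburger_hamiltonian l phi H)
  (hW : forall z : R[i],
     fundamental_solution H (total_length l) z (fun t => W t z))
  (hdl : regularly_varying dl (- delta_l))
  (hdphi : regularly_varying dphi (- delta_phi))
  (hdelta : 0 < delta_phi < 1)
  (hl : lesssim \oo (fun j : nat => (dl j%:R)%:E) (fun j => (l j)%:E))
  (hphi : asymp \oo (fun j : nat => `|phi j.+1 - phi j|%:E)
                    (fun j => (dphi j%:R)%:E))
  (hmon : eventually_monotone phi).
Let L := total_length l.
Let w22 (r : R) : R := cmod (W L (0 +i* r) 1 1).

Lemma lesssim_real_nat (f g : nat -> R) :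
  lesssim \oo (fun j => (f j)%:E) (fun j => (g j)%:E) ->
  exists C N, 0 < C /\ forall j, (N <= j)%N -> f j <= C * g j.
Proof.
move=> [C C0 [N _ h]]; exists C, N; by split.
Qed.

Lemma dl_index_ge1 : 1 <= delta_l.
Proof.
have [C [N [C0 h]]] := lesssim_real_nat hl.
exact: (index_ge1_of_bounded_sums hdl (lengths_ge0 hH) h C0 (node_le_length hH)).
Qed.

(** [w22] is the limit of the nondecreasing moduli along the nodes. *)
Lemma csq_snd_le_w22 r n : 0 <= r ->
  csq (row_traj (0 +i* r) l phi (unit2 R) n).2 <= w22 r ^+ 2.
Proof.
move=> r0.
have inc k : csq (row_traj (0 +i* r) l phi (unit2 R) n).2 <=
             csq (row_traj (0 +i* r) l phi (unit2 R) (n + k)).2.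
  elim: k => [|k IH]; first by rewrite addn0.
  by rewrite addnS (le_trans IH) // csq_snd_incr // => j; exact: (lengths_ge0 hH).
rewrite -cmod_csq ler_sqr ?nnegrE ?cmod_ge0 //.
apply/ler_addgt0Pr => e e0.
have [N hN] := sol_row_cvg hH (hW (0 +i* r)) 1 1 e0.
have h := hN (n + N)%N (leq_addl _ _).
have E : W (node l (n + N)) (0 +i* r) 1 1 = (row_traj (0 +i* r) l phi (unit2 R) (n + N)).2.
  have := sol_row_node hH (hW (0 +i* r)) (n + N) 1.
  rewrite !mxE /= => /(congr1 snd) /= -> //.
rewrite E in h.
apply: (@le_trans _ _ (cmod (row_traj (0 +i* r) l phi (unit2 R) (n + N)).2)).
  by rewrite -ler_sqr ?nnegrE ?cmod_ge0 // !cmod_csq inc.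
apply: le_trans (_ : w22 r + cmod (W L (0 +i* r) 1 1 - (row_traj (0 +i* r) l phi (unit2 R) (n + N)).2) <= _); last by rewrite lerD2l ltW.
set x := (row_traj _ _ _ _ _).2; rewrite /w22; set y := W _ _ _ _.
have -> : x = y + - (y - x) by ring.
apply: le_trans (cmodD _ _) _; rewrite cmodN.
by have -> : y - (y + - (y - x)) = y - x by ring.
Qed.

(** The lengths after an index [N] are decreased to [dl j / C]; the first ones are
    kept, so that the initial energy is at least a multiple of [r], which cancels
    the factor [r] lost in [energy_le_snd]. *)
Lemma log_w22_ge_tail_sum : exists c K (N : nat), 0 < c /\ forall r n M, 0 < r -> (N <= n)%N ->
  (forall j, (n <= j)%N -> r * dl j%:R <= dphi j%:R) -> (n <= M)%N ->
  0 < w22 r /\ c * (r * \sum_(n <= j < M) dl j.+1%:R) - K <= ln (w22 r).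
Proof.
have [dl0 dphi0] : (forall t, 1 <= t -> 0 < dl t) /\ (forall t, 1 <= t -> 0 < dphi t).
  by case: hdl hdphi => _ ? _ [].
have [X1 [C1 [X11 C11 h1]]] := regularly_varying_doubling hdl.
have [X2 [C2 [X21 C21 h2]]] := regularly_varying_doubling hdphi.
have [C3 [N3 [C30 h3]]] := lesssim_real_nat hl.
have [C4 [N4 [C40 h4]]] := lesssim_real_nat (proj1 hphi).
have [C5 [N5 [C50 h5]]] := lesssim_real_nat (proj2 hphi).
pose C := C1 + C2 + C3 + C4 + C5.
have CC1 : C1 <= C by rewrite /C; lra.
have CC2 : C2 <= C by rewrite /C; lra.
have CC3 : C3 <= C by rewrite /C; lra.
have CC4 : C4 <= C by rewrite /C; lra.
have CC5 : C5 <= C by rewrite /C; lra.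
have Cge1 : 1 <= C by rewrite /C; lra.
have C0 : 0 < C by lra.
have [hd0 hd1] := andP hdelta.
have C20 : 0 < (C ^+ 2)^-1 by rewrite invr_gt0 exprn_gt0.
have [X6 X61 h6] := regularly_varying_small hdphi hd0 C20.
have [X7 X71 h7] := regularly_varying_times_large 2 hdphi hd1.
have [N1 k1] := nat_above X1; have [N2 k2] := nat_above X2.
have [N6 k6] := nat_above X6; have [N7 k7] := nat_above X7.
have [N8 k8] := hmon.
pose N := (N1 + N2 + N3 + N4 + N5 + N6 + N7 + N8 + 2)%N.
have NE : (N1 + N2 + N3 + N4 + N5 + N6 + N7 + N8 + 2 <= N)%N by [].
clearbody N.
have [c0 c00 hc0] : exists2 c, 0 < c & forall r n, 0 <= r -> (2 <= n)%N ->
    c * r <= energy (row_traj (0 +i* r)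
        (fun j => if (j <= N)%N then l j else dl j%:R / C) phi (unit2 R) n).
  case: hH => l0 _ hphi0 _; apply: energy_linear_lower; last exact: hphi0 1%N isT.
  move=> j j1; case: ifP => _; first exact: l0.
  by rewrite divr_gt0 // dl0 // ler1n.
pose l' j := if (j <= N)%N then l j else dl j%:R / C.
have D0 j : (N <= j)%N -> 0 < dl j%:R by move=> Nj; apply: dl0; rewrite ler1n; nat_lia.
have F0 j : (N <= j)%N -> 0 < dphi j%:R by move=> Nj; apply: dphi0; rewrite ler1n; nat_lia.
have l'0 j : (1 <= j)%N -> 0 <= l' j.
  rewrite /l'; case: (leqP j N) => Nj j1; first exact: (lengths_ge0 hH).
  by rewrite divr_ge0 ?(ltW C0) // ltW // D0 // ltnW.
have l'l j : (1 <= j)%N -> l' j <= l j.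
  rewrite /l'; case: (leqP j N) => Nj j1 //.
  rewrite ler_pdivrMr // mulrC; apply: (le_trans (h3 j ltac:(nat_lia))).
  by rewrite ler_wpM2r // (lengths_ge0 hH).
have lD j : (N < j)%N -> l' j = dl j%:R / C.
  by rewrite /l' ltnNge => /negbTE ->.
have Dcomp n j : (N <= n)%N -> (n <= j <= 2 * n)%N ->
   dl j%:R <= C * dl n%:R /\ dl n%:R <= C * dl j%:R.
  move=> Nn nj; have [g1 g2] := h1 n%:R j%:R (k1 n ltac:(nat_lia)) ltac:(by rewrite -natrM !ler_nat).
  have dn := D0 _ Nn; have dj := D0 j ltac:(nat_lia).
  split; [apply: (le_trans g1)|apply: (le_trans g2)]; by rewrite ler_wpM2r // ltW.
have Fcomp n j : (N <= n)%N -> (n <= j <= 2 * n)%N ->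
   dphi j%:R <= C * dphi n%:R /\ dphi n%:R <= C * dphi j%:R.
  move=> Nn nj; have [g1 g2] := h2 n%:R j%:R (k2 n ltac:(nat_lia)) ltac:(by rewrite -natrM !ler_nat).
  have dn := F0 _ Nn; have dj := F0 j ltac:(nat_lia).
  split; [apply: (le_trans g1)|apply: (le_trans g2)]; by rewrite ler_wpM2r // ltW.
have Fphi n : (N <= n)%N -> `|phi n.+1 - phi n| <= C * dphi n%:R /\
    dphi n%:R <= C * `|phi n.+1 - phi n|.
  move=> Nn; have g1 := h4 n ltac:(nat_lia); have g2 := h5 n ltac:(nat_lia).
  split; [apply: (le_trans g1)|apply: (le_trans g2)]; rewrite ler_wpM2r //.
  exact/ltW/F0.
have mon : (forall m n, (N <= m)%N -> (m <= n)%N -> phi m <= phi n) \/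
         (forall m n, (N <= m)%N -> (m <= n)%N -> phi n <= phi m).
  case: k8 => k8; [left|right] => m n Nm mn.
    have := k8 (m - N8)%N (n - N8)%N ltac:(nat_lia).
    by rewrite !subnKC //; nat_lia.
  have := k8 (m - N8)%N (n - N8)%N ltac:(nat_lia).
  by rewrite !subnKC //; nat_lia.
have Fsmall n : (N <= n)%N -> C ^+ 2 * dphi n%:R <= 1.
  move=> Nn; rewrite -ler_pdivlMl ?exprn_gt0 // mulr1; apply/h6/k6.
  by nat_lia.
have Flarge n : (N <= n)%N -> 2 <= n%:R * dphi n%:R.
  by move=> Nn; apply/h7/k7; nat_lia.
have N1' : (1 <= N)%N by nat_lia.
have g0 := gain_rate_gt0 Cge1.
have L0 : 0 < L.
  apply: lt_le_trans (node_le_length hH 1); rewrite nodeS node0 add0r.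
  by case: hH => l0 _ _ _; exact: l0.
exists (gain_rate C / 2), ((ln L - ln c0) / 2), N; split; first by rewrite divr_gt0.
move=> r n M r0 Nn rDF nM.
have nodeL k : node l' k <= L.
  apply: le_trans (node_le_length hH k); rewrite /node [leLHS]big_nat_cond [leRHS]big_nat_cond.
  by apply: ler_sum => j /andP[/andP[j1 _] _]; exact: l'l.
have h := @snd_exponential_growth R l' phi (fun j => dl j%:R) (fun j => dphi j%:R) N C
  Cge1 N1' l'0 lD D0 F0 Dcomp Fcomp Fphi mon Fsmall Flarge l L (w22 r ^+ 2) r n M
  (ltW r0) Nn rDF nM (lengths_ge0 hH) l'l nodeL (fun k => csq_snd_le_w22 k (ltW r0)).
have hc := hc0 r n (ltW r0) ltac:(nat_lia).
set S := \sum_(_ <= _ < _) _ in h *.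
have {}h : expR (gain_rate C * (r * S)) * c0 <= L * w22 r ^+ 2.
  rewrite -(ler_pM2l r0) [leRHS]mulrA; apply: le_trans h.
  by rewrite mulrCA ler_wpM2l ?expR_ge0 // mulrC.
have w0 : 0 < w22 r.
  rewrite lt_neqAle cmod_ge0 andbT eq_sym; apply/eqP => w0.
  move: h; rewrite w0 expr0n mulr0 leNgt mulr_gt0 // expR_gt0 //.
split=> //.
have : ln (expR (gain_rate C * (r * S)) * c0) <= ln (L * w22 r ^+ 2).
  by rewrite ler_ln ?posrE ?mulr_gt0 ?expR_gt0 // exprn_gt0.
rewrite !lnM ?posrE ?expR_gt0 ?exprn_gt0 // expRK. lra.
Qed.

End Growth.

(** * The asymptotic inverse and the tail integral *)

Section Inverse.
Variable R : realType.
Implicit Types (a d : R -> R).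
Local Notation mu := (@lebesgue_measure R).

(** The set in the definition of the asymptotic inverse is nonempty and bounded for
    large [r], so its supremum is approached within distance 1. *)
Lemma asymptotic_inverse_spec a :
  (forall K, exists2 Y, 1 <= Y & forall y, Y <= y -> K <= a y) ->
  forall X, exists2 R0, 1 <= R0 & forall r, R0 <= r ->
    let T := asymptotic_inverse a r in
    [/\ X <= T, 1 <= T, (forall t, T < t -> r <= a t) &
        exists t, [/\ T - 1 < t, t <= T, 1 <= t & a t < r]].
Proof.
move=> a_oo X; pose Z := Num.max X 1.
have Z1 : 1 <= Z by rewrite le_max lexx orbT.
exists (Num.max 1 (a Z + 1)); first by rewrite le_max lexx.
move=> r; rewrite ge_max => /andP[r1 rZ] T.
have SZ : [set t | 1 <= t /\ a t < r] Z by split => //; lra.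
have hS : has_sup [set t | 1 <= t /\ a t < r].
  split; first by exists Z.
  have [Y _ hY] := a_oo r; exists Y => t [_ tr].
  by rewrite leNgt; apply/negP => /ltW/hY; rewrite leNgt tr.
have ZT : Z <= T by exact: sup_upper_bound.
have T1 : 1 <= T by exact: le_trans ZT.
split => //; first by apply: le_trans ZT; rewrite le_max lexx.
- move=> t Tt; rewrite leNgt; apply/negP => tr.
  have : t <= T by apply: sup_upper_bound => //; split => //; exact: le_trans (ltW Tt).
  by rewrite leNgt Tt.
- have [t [t1 tr] tT] := sup_adherent ltr01 hS.
  by exists t; split => //; exact: sup_upper_bound.
Qed.

(** Compares [d] on [[k, k + 1]] with [d (k + 2)], by the doubling property used
    twice; the shift by 2 lets the sum start after [T]. *)
Lemma integral_tail_le d (delta : R) : regularly_varying d delta ->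
  exists X C, [/\ 1 <= X, 0 < C & forall T B, X <= T ->
   (forall M, ((Num.truncn T).+1 <= M)%N ->
      \sum_((Num.truncn T).+1 <= j < M) d j.+1%:R <= B) ->
   (\int[lebesgue_measure]_(x in `[T, +oo[) (d x)%:E <= (C * B)%:E)%E].
Proof.
move=> rv; have [X0 [C [X01 C1 h]]] := regularly_varying_doubling rv.
have [md d0 _] := rv.
exists (X0 + 2), (C * C); split; first lra.
  by rewrite mulr_gt0 // (lt_le_trans ltr01).
move=> T B XT hB.
have T0 : 0 <= T by lra.
pose k0 := Num.truncn T.
have /andP[k0T Tk0] := truncn_itv T0; rewrite -/k0 in k0T Tk0.
have k0X : X0 + 1 <= k0%:R by move: Tk0; rewrite -natr1; lra.
pose F (i : nat) : set R := `[(k0 + i)%:R, (k0 + i).+1%:R[%classic.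
have mF i : measurable (F i) by exact: measurable_itv.
have kX i : X0 + 1 <= (k0 + i)%:R.
  by apply: le_trans k0X _; rewrite ler_nat leq_addr.
have F1 i x : F i x -> 1 <= x.
  by rewrite /F /= in_itv /= => /andP[h1 _]; have := kX i; lra.
have sub : `[T, +oo[ `<=` \bigcup_i F i.
  move=> x /=; rewrite in_itv /= andbT => Tx.
  have x0 : 0 <= x by exact: le_trans Tx.
  have /andP[h1 h2] := truncn_itv x0.
  have le : (k0 <= Num.truncn x)%N by apply: le_truncn.
  by exists (Num.truncn x - k0)%N => //; rewrite /F /= subnKC // in_itv /= h1 h2.
have mdE (D : set R) : measurable D -> (forall x, D x -> 1 <= x) ->
    measurable_fun D (fun x => (d x)%:E).
  move=> mD D1; apply/measurable_EFinP; apply: measurable_funS md => //.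
  by move=> x /D1; rewrite /= in_itv /= andbT.
have mU : measurable (\bigcup_i F i) by exact: bigcupT_measurable.
have U1 x : (\bigcup_i F i) x -> 1 <= x by move=> [i _ /F1].
have U0 x : (\bigcup_i F i) x -> (0 <= (d x)%:E)%E.
  by move=> /U1 x1; rewrite lee_fin ltW // d0.
apply: (@le_trans _ _ (\int[mu]_(x in \bigcup_i F i) (d x)%:E)%E).
  by apply: ge0_subset_integral => //; exact: mdE.
rewrite ge0_integral_bigcup //; [|exact: mdE|].
  2: {
  apply/trivIsetP => i j _ _ ij; apply/seteqP; split=> x //=.
  rewrite /F /= !in_itv /= => -[/andP[a1 a2] /andP[b1 b2]].
  have := le_lt_trans a1 b2; have := le_lt_trans b1 a2; rewrite !ltr_nat => c1 c2.
  by move/eqP: ij; apply; clear -c1 c2; lia. }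
have dk x k : X0 <= k%:R -> k%:R <= x <= k.+1%:R -> d x <= C * d k%:R.
  move=> Xk /andP[kx xk]; have [|//] := h k%:R x Xk.
  by rewrite kx /=; move: xk; rewrite -natr1; lra.
have term i : (\int[mu]_(x in F i) (d x)%:E <= (C * C * d (k0.+1 + i).+1%:R)%:E)%E.
  have Xi : X0 <= (k0 + i)%:R by have := kX i; lra.
  have ki2 : 2 <= (k0 + i)%:R :> R by have := kX i; lra.
  have i1 : 1 <= (k0 + i)%:R :> R by lra.
  apply: (@le_trans _ _ (\int[mu]_(x in F i) cst (C * d (k0 + i)%:R)%:E x)%E).
    apply: ge0_le_integral; [exact: mF| | | |].
    - by move=> x /F1 x1; rewrite lee_fin ltW // d0.
    - by apply: mdE; [exact: mF|exact: F1].
    - exact: measurable_cst.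
    - move=> x; rewrite /F /= in_itv /= => /andP[x1 x2]; rewrite lee_fin.
      by apply: dk => //; rewrite x1 ltW.
  rewrite integral_cst; [|exact: mF]. rewrite /F [X in (_ * X <= _)%E](lebesgue_measure_itv `[_, _[) /= lte_fin ltr_nat leqnn.
  rewrite -EFinB -natr1 addrAC subrr add0r mule1 lee_fin -mulrA.
  rewrite ler_wpM2l ?(le_trans ler01) //.
  have [|_ //] := h (k0 + i)%:R (k0.+1 + i).+1%:R Xi.
  rewrite ler_nat !addSn !leqW // -!natr1; lra.
apply: lime_le.
  by apply: is_cvg_nneseries => i _ _; apply: integral_ge0 => x /F1 x1; rewrite lee_fin ltW // d0.
exists 0%N => // K _ /=.
apply: (@le_trans _ _ (\sum_(0 <= i < K) (C * C * d (k0.+1 + i).+1%:R)%:E)%E).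
  by apply: lee_sum => i _; exact: term.
rewrite sumEFin lee_fin -mulr_sumr ler_wpM2l ?mulr_ge0 ?(le_trans ler01) //.
apply: le_trans (hB (k0.+1 + K)%N (leq_addr _ _)).
rewrite -/k0 -{2}(add0n k0.+1) (addnC k0.+1 K) big_addn addnK.
by rewrite le_eqVlt; apply/orP; left; apply/eqP; apply: eq_bigr => i _; rewrite (addnC i).
Qed.

End Inverse.

(** * Size of the tail sum *)

Section TailSum.
Variables (R : realType) (dl dphi : R -> R) (delta_l delta_phi : R).
Hypotheses (hdl : regularly_varying dl (- delta_l))
  (hdphi : regularly_varying dphi (- delta_phi))
  (hlt : delta_phi < delta_l).
Let ratio (t : R) := dphi t / dl t.

Lemma ratio_large K : exists2 Y, 1 <= Y & forall y, Y <= y -> K <= ratio y.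
Proof.
pose eps := (delta_l - delta_phi) / 4.
have eps0 : 0 < eps by rewrite divr_gt0 // subr_gt0.
have [X [c [C [X1 c0 C0 h]]]] := regularly_varying_ratio hdphi hdl eps0.
have [|Y Y1 hY] := @powR_large R (delta_l - delta_phi - 2 * eps) (K / c).
  by have := hlt; rewrite /eps; lra.
exists (Num.max X Y); first by rewrite le_max X1.
move=> y; rewrite ge_max => /andP[/h[h1 _] /hY h2].
by apply: le_trans h1; rewrite mulrC -ler_pdivrMr.
Qed.

(** Only the terms between [n] and [2 n] are used.  There [r] is comparable to
    [dphi n / dl n], so the sum is at least a multiple of [n * dphi n], while [r] is
    at most a power of [n]. *)
Lemma tail_sum_lower (g : R) : 0 < g -> g * (delta_l - delta_phi) < 1 - delta_phi ->
  exists c R1, [/\ 0 < c, 1 <= R1 & forall r n, R1 <= r ->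
    n = (Num.truncn (asymptotic_inverse ratio r)).+1 ->
    c * r `^ g <= r * \sum_(n <= j < n + n) dl j.+1%:R].
Proof.
move=> g0 hg.
have [_ dl0 _] := hdl; have [_ dphi0 _] := hdphi.
(* This loss in the exponents makes the two powers of [n] match: see [epsE]. *)
pose eps := ((1 - delta_phi) - g * (delta_l - delta_phi)) / (1 + 2 * g).
have g12 : 0 < 1 + 2 * g by lra.
have eps0 : 0 < eps by rewrite divr_gt0 // subr_gt0.
have epsE : 1 - delta_phi - eps = g * (delta_l - delta_phi + 2 * eps).
  have : eps * (1 + 2 * g) = (1 - delta_phi) - g * (delta_l - delta_phi).
    by rewrite divfK // gt_eqF.
  by lra.
have [X1 [c1 [C1 [X11 c10 C10 h1]]]] := regularly_varying_ratio hdphi hdl eps0.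
have [X2 [c2 [C2 [X21 c20 C20 h2]]]] := regularly_varying_powers hdphi eps0.
have [X3 [C3 [X31 C31 h3]]] := regularly_varying_doubling hdl.
have [X4 [C4 [X41 C41 h4]]] := regularly_varying_doubling hdphi.
have [R0 R01 hR] := asymptotic_inverse_spec ratio_large (X1 + X2 + X3 + X4 + 3).
have C30 : 0 < C3 by lra.
have C40 : 0 < C4 by lra.
pose c := c2 / (C3 * (C4 * C3)) / C1 `^ g.
have c_gt0 : 0 < c.
  by rewrite /c divr_gt0 ?powR_gt0 // divr_gt0 // !mulr_gt0.
exists c, R0; split; [exact: c_gt0|exact: R01|move=> r n Rr nE].
have [TX T1 hT [t [tT1 tT t1 tr]]] := hR r Rr.
set T := asymptotic_inverse _ _ in TX T1 hT tT1 tT nE.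
have r0 : 0 < r by lra.
have T0 : 0 <= T by lra.
have /andP[nT Tn] := truncn_itv T0; rewrite -nE in Tn.
have nT1 : n%:R <= T + 1 by rewrite nE -natr1 lerD2r.
have n1 : 1 <= n%:R :> R by lra.
have n0 : 0 < n%:R :> R by lra.
have dln := dl0 _ n1; have dphin := dphi0 _ n1.
have rn : r <= ratio n%:R by exact: hT.
have nr : dphi n%:R <= C4 * C3 * (r * dl n%:R).
  have dlt := dl0 _ t1; have dphit := dphi0 _ t1.
  have tn : t <= n%:R <= 2 * t by apply/andP; split; lra.
  have [k1 _] := h4 t n%:R ltac:(lra) tn.
  have [_ k2] := h3 t n%:R ltac:(lra) tn.
  apply: (le_trans k1); rewrite -mulrA ler_wpM2l ?(ltW C40) //.
  have k3 : dphi t <= r * dl t by rewrite -ler_pdivrMr // ltW.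
  by apply: (le_trans k3); rewrite mulrCA ler_wpM2l // ltW.
have sumn : n%:R * (dl n%:R / C3) <= \sum_(n <= j < n + n) dl j.+1%:R.
  rewrite mulr_natl -[X in _ *+ X](addKn n n) -sumr_const_nat.
  rewrite [leLHS]big_nat_cond [leRHS]big_nat_cond.
  apply: ler_sum => j /andP[/andP[j1 j2] _].
  have nj : (n%:R <= j.+1%:R :> R) && (j.+1%:R <= 2 * n%:R :> R).
    apply/andP; split; first by rewrite ler_nat; clear -j1 j2; lia.
    by rewrite -natrM ler_nat; clear -j1 j2; lia.
  have [_ k] := h3 n%:R j.+1%:R ltac:(lra) nj.
  by rewrite ler_pdivrMr // mulrC.
have step1 : n%:R * dphi n%:R / (C3 * (C4 * C3)) <= r * \sum_(n <= j < n + n) dl j.+1%:R.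
  apply: (@le_trans _ _ (r * (n%:R * (dl n%:R / C3)))); last by rewrite ler_wpM2l // ltW.
  rewrite ler_pdivrMr ?mulr_gt0 //.
  apply: (@le_trans _ _ (n%:R * (C4 * C3 * (r * dl n%:R)))); first by rewrite ler_wpM2l // ltW.
  by rewrite le_eqVlt; apply/orP; left; apply/eqP; field; rewrite gt_eqF.
apply: le_trans step1.
have [k1 _] := h2 n%:R ltac:(lra).
have [_ k2] := h1 n%:R ltac:(lra).
have k3 : r / C1 <= n%:R `^ (delta_l - delta_phi + 2 * eps).
  by rewrite ler_pdivrMr // mulrC; exact: (le_trans rn).
have k4 : (r / C1) `^ g <= n%:R `^ (1 - delta_phi - eps).
  rewrite epsE (mulrC g) powRrM; apply: ge0_ler_powR => //.
  - exact: ltW.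
  - by rewrite nnegrE divr_ge0 // ltW.
  - by rewrite nnegrE powR_ge0.
have k5 : c2 * n%:R `^ (1 - delta_phi - eps) <= n%:R * dphi n%:R.
  apply: (@le_trans _ _ (n%:R * (c2 * n%:R `^ (- delta_phi - eps)))); last first.
    by rewrite ler_wpM2l // ltW.
  rewrite mulrCA ler_wpM2l ?(ltW c20) // -{2}(powRr1 (ltW n0)) -powRD ?(gt_eqF n0) ?implybT //.
  by rewrite le_eqVlt; apply/orP; left; apply/eqP; congr (_ `^ _); ring.
have rE : (r / C1) `^ g = r `^ g / C1 `^ g.
  rewrite powRM ?invr_ge0 ?(ltW r0) ?(ltW C10) //; congr (_ * _).
  by rewrite -powR_inv1 ?(ltW C10) // -powRrM mulN1r powRN.
apply: (@le_trans _ _ (c2 * (r / C1) `^ g / (C3 * (C4 * C3)))).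
  rewrite rE /c le_eqVlt; apply/orP; left; apply/eqP; field.
  by rewrite !gt_eqF ?powR_gt0.
rewrite ler_wpM2r ?invr_ge0 ?mulr_ge0 ?(ltW C30) ?(ltW C40) //.
by apply: le_trans k5; rewrite ler_wpM2l // ltW.
Qed.

End TailSum.

(** * The lower bounds for the monodromy matrix *)

Section Final.
Variables (R : realType) (H : R -> 'M[R]_2) (l phi : nat -> R)
  (W : R -> R[i] -> 'M[R[i]]_2) (dl dphi : R -> R) (delta_l delta_phi : R).
Hypotheses (hH : hamburger_hamiltonian l phi H)
  (hW : forall z : R[i],
     fundamental_solution H (total_length l) z (fun t => W t z))
  (hdl : regularly_varying dl (- delta_l))
  (hdphi : regularly_varying dphi (- delta_phi))
  (hdelta : 0 < delta_phi < 1)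
  (hl : lesssim \oo (fun j : nat => (dl j%:R)%:E) (fun j => (l j)%:E))
  (hphi : asymp \oo (fun j : nat => `|phi j.+1 - phi j|%:E)
                    (fun j => (dphi j%:R)%:E))
  (hmon : eventually_monotone phi).
Let L := total_length l.
Let w22 (r : R) : R := cmod (W L (0 +i* r) 1 1).
Let T (r : R) : R := asymptotic_inverse (fun t => dphi t / dl t) r.
Let rho : R := (1 - delta_phi) / (delta_l - delta_phi).

Let hlt : delta_phi < delta_l.
Proof. by have := dl_index_ge1 hH hdl hl; case/andP: hdelta => _ h1; exact: lt_le_trans. Qed.

Lemma row_traj_bound (z : R[i]) v n :
  cmod (row_traj z l phi v n).1 + cmod (row_traj z l phi v n).2 <=
  expR (2 * cmod z * node l n) * (cmod v.1 + cmod v.2).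
Proof.
elim: n => [|n IH]; first by rewrite node0 mulr0 expR0 mul1r.
have ln := lengths_ge0 hH (ltn0Sn n).
rewrite nodeS (mulrDr (2 * cmod z)) expRD (mulrC (expR _) (expR _)) -[leRHS]mulrA.
set V := row_traj z l phi v n in IH *.
have pV : cmod (proj_dir (phi n.+1) V) <= cmod V.1 + cmod V.2.
  apply: le_trans (cmodD _ _) _; rewrite !cmodM !cmod_real.
  by apply: lerD; rewrite ler_piMr ?cmod_ge0 // ler_norml ?cos_geN1 ?cos_le1 ?sin_geN1 ?sin_le1.
have st (x : R) : `|x| <= 1 ->
   cmod (z * (l n.+1)%:C * proj_dir (phi n.+1) V * x%:C) <=
   cmod z * l n.+1 * (cmod V.1 + cmod V.2).
  move=> x1; rewrite !cmodM !cmod_real (ger0_norm ln).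
  apply: le_trans (_ : cmod z * l n.+1 * cmod (proj_dir (phi n.+1) V) <= _).
    by rewrite ler_piMr // !mulr_ge0 ?cmod_ge0.
  by rewrite ler_wpM2l // mulr_ge0 ?cmod_ge0.
have c1 : `|cos (phi n.+1)| <= 1 by rewrite ler_norml cos_geN1 cos_le1.
have s1 : `|sin (phi n.+1)| <= 1 by rewrite ler_norml sin_geN1 sin_le1.
apply: (@le_trans _ _ ((1 + 2 * cmod z * l n.+1) * (cmod V.1 + cmod V.2))).
  have := st _ c1; have := st _ s1; rewrite /= /row_step -/V /=.
  have := cmodD V.1 (- (z * (l n.+1)%:C * proj_dir (phi n.+1) V * (sin (phi n.+1))%:C)).
  have := cmodD V.2 (z * (l n.+1)%:C * proj_dir (phi n.+1) V * (cos (phi n.+1))%:C).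
  by rewrite cmodN; lra.
apply: ler_pM => //; rewrite ?addr_ge0 ?cmod_ge0 ?mulr_ge0 ?cmod_ge0 //.
exact: expR_ge1Dx.
Qed.

(** Boundedness on circles is needed because [max_modulus] is a supremum of reals,
    meaningless for an unbounded set. *)
Lemma monodromy_bound (z : R[i]) i j : cmod (W L z i j) <= expR (2 * cmod z * L) + 1.
Proof.
have [N hN] := sol_row_cvg hH (hW z) i j (@ltr01 R).
have {}hN := hN N (leqnn N).
have hv : cmod (1%:M i 0 : R[i]) + cmod (1%:M i 1 : R[i]) <= 1.
  have cm (b : bool) : cmod (b%:R : R[i]) = b%:R :> R.
    by rewrite -(rmorph_nat (real_complex R)) cmod_real ger0_norm ?ler0n.
  rewrite !mxE !cm.
  by case: i {hN} => -[|[|//]] i2 /=; rewrite ?addr0 ?add0r.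
have E := sol_row_node hH (hW z) N i.
have hb : cmod (W (node l N) z i j) <= expR (2 * cmod z * L).
  have := row_traj_bound z (1%:M i 0, 1%:M i 1) N; rewrite -E /sol_row /= => h.
  apply: (@le_trans _ _ (cmod (W (node l N) z i 0) + cmod (W (node l N) z i 1))).
    case: j {hN} => -[|[|//]] j2.
      by rewrite (_ : Ordinal j2 = 0) ?lerDl ?cmod_ge0 //; exact: val_inj.
    by rewrite (_ : Ordinal j2 = 1) ?lerDr ?cmod_ge0 //; exact: val_inj.
  apply: (le_trans h); apply: (@le_trans _ _ (expR (2 * cmod z * node l N))).
    by rewrite ler_piMr ?expR_ge0.
  by rewrite ler_expR ler_wpM2l ?mulr_ge0 ?cmod_ge0 // (node_le_length hH).
have -> : W L z i j = W (node l N) z i j + (W L z i j - W (node l N) z i j) by ring.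
by apply: le_trans (cmodD _ _) _; rewrite lerD // ltW.
Qed.

Lemma w22_le_max_modulus r : 0 <= r -> w22 r <= max_modulus (W L) r.
Proof.
move=> r0; have cr : cmod (0 +i* r : R[i]) = r.
  by rewrite /cmod /= expr0n add0r sqrtr_sqr ger0_norm.
apply: (@le_trans _ _ (cmx_norm (W L (0 +i* r)))).
  rewrite /cmx_norm; apply: le_trans (le_bigmax _ _ (1 : 'I_2)).
  exact: (le_bigmax _ (fun j : 'I_2 => cmod (W L (0 +i* r) 1 j)) (1 : 'I_2)).
apply: sup_upper_bound; last by exists (0 +i* r).
split; first by exists (cmx_norm (W L (0 +i* r))); exists (0 +i* r).
exists (expR (2 * r * L) + 1) => _ [z /= zr <-].
have e0 : 0 <= expR (2 * r * L) + 1 by rewrite addr_ge0 ?expR_ge0.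
apply: bigmax_le => // i _; apply: bigmax_le => // j _.
by rewrite -zr; exact: monodromy_bound.
Qed.

(** Beyond [T r] the quotient [dphi / dl] is at least [r], which is the regime of
    the averaging argument. *)
Lemma inverse_range X : exists2 R0, 1 <= R0 & forall r, R0 <= r ->
  [/\ X <= T r, 1 <= T r & forall j, ((Num.truncn (T r)).+1 <= j)%N ->
      r * dl j%:R <= dphi j%:R].
Proof.
have [R0 R01 h] := asymptotic_inverse_spec (ratio_large hdl hdphi hlt) X.
exists R0 => // r /h[h1 h2 h3 _]; split=> // j nj.
have Tj : T r < j%:R.
  by apply: lt_le_trans (truncnS_gt (T r)) _; rewrite ler_nat.
have := h3 _ Tj; rewrite ler_pdivlMr //.
by case: hdl => _ dl0 _; apply: dl0; exact: le_trans (ltW Tj).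
Qed.

Lemma log_w22_ge_inverse_tail_sum : exists c K R0, [/\ 0 < c, 1 <= R0 & forall r M, R0 <= r ->
  ((Num.truncn (T r)).+1 <= M)%N ->
  0 < w22 r /\
  c * (r * \sum_((Num.truncn (T r)).+1 <= j < M) dl j.+1%:R) - K <= ln (w22 r)].
Proof.
have [c [K [N [c0 h]]]] := log_w22_ge_tail_sum hH hW hdl hdphi hdelta hl hphi hmon.
have [R0 R01 hR] := inverse_range N%:R.
exists c, K, R0; split=> // r M Rr nM; have [NT T1 hT] := hR r Rr.
apply: h => //; first lra.
by rewrite -(ler_nat R) (le_trans NT) // ltW // truncnS_gt.
Qed.

Lemma log_w22_ge_power g : 0 < g -> g < rho -> exists c R0, [/\ 0 < c, 1 <= R0 &
  forall r, R0 <= r -> c * r `^ g <= ln (w22 r)].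
Proof.
move=> g0 grho.
have hg : g * (delta_l - delta_phi) < 1 - delta_phi.
  by rewrite -ltr_pdivlMr // subr_gt0.
have [c [K [R0 [c0 R01 h]]]] := log_w22_ge_inverse_tail_sum.
have [c' [R1 [c'0 R11 h']]] := tail_sum_lower hdl hdphi hlt g0 hg.
have cc' : 0 < c * c' by rewrite mulr_gt0.
have [R2 R21 h2] := powR_large (2 * K / (c * c')) g0.
exists (c * c' / 2), (R0 + R1 + R2); split; [by rewrite divr_gt0|lra|move=> r Rr].
have r0 : 0 < r by lra.
pose n := (Num.truncn (T r)).+1.
have [_ k1] := h r (n + n)%N ltac:(lra) (leq_addr _ _).
have k2 := h' r n ltac:(lra) erefl.
have k3 : 2 * K <= r `^ g * (c * c') by rewrite -ler_pdivrMr //; apply: h2; lra.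
have k4 : c * (c' * r `^ g) <= c * (r * \sum_(n <= j < n + n) dl j.+1%:R).
  by rewrite ler_wpM2l // ltW.
rewrite -/n in k1; lra.
Qed.

Lemma rho_gt0 : 0 < rho.
Proof. by have /andP[_ h1] := hdelta; rewrite divr_gt0 // subr_gt0. Qed.

(** [log_w22_ge_power] makes [K] at most [ln (w22 r)], so that it can be absorbed
    into the constant. *)
Lemma log_w22_lower_bound : lesssim (pinfty_nbhs R)
    (fun r : R => r%:E * \int[lebesgue_measure]_(x in `[T r, +oo[) (dl x)%:E)%E
    (fun r : R => (ln (w22 r))%:E).
Proof.
have [c [K [R0 [c0 R01 h]]]] := log_w22_ge_inverse_tail_sum.
have r20 : 0 < rho / 2 by rewrite divr_gt0 // rho_gt0.
have r2r : rho / 2 < rho by rewrite ltr_pdivrMr // ltr_pMr ?rho_gt0 // ltr1n.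
have [c' [R1 [c'0 R11 h']]] := log_w22_ge_power r20 r2r.
have [R2 R21 h2] := powR_large (K / c') r20.
have [X [C [X1 C0 hI]]] := integral_tail_le hdl.
have [R3 R31 h3] := inverse_range X.
exists (C * (2 / c)); first by rewrite mulr_gt0 // divr_gt0.
exists (R0 + R1 + R2 + R3); split; first exact: num_real.
move=> r Rr; have r0 : 0 < r by lra.
have KW : K <= ln (w22 r).
  have k1 := h' r ltac:(lra); have k2 := h2 r ltac:(lra).
  by apply: le_trans k1; rewrite mulrC -ler_pdivrMr.
have [XT _ _] := h3 r ltac:(lra).
have hB M : ((Num.truncn (T r)).+1 <= M)%N ->
    \sum_((Num.truncn (T r)).+1 <= j < M) dl j.+1%:R <= 2 / c * ln (w22 r) / r.
  move=> nM; have [_ k] := h r M ltac:(lra) nM.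
  rewrite ler_pdivlMr // mulrAC ler_pdivlMr // mulrC (mulrC _ r); lra.
have Ile := hI (T r) _ XT hB.
apply: (@le_trans _ _ (r%:E * (C * (2 / c * ln (w22 r) / r))%:E)%E).
  by apply: lee_wpmul2l => //; rewrite lee_fin ltW.
rewrite -!EFinM lee_fin le_eqVlt; apply/orP; left; apply/eqP; field.
by rewrite !gt_eqF.
Qed.

Lemma loglog_large g : 0 < g -> g < rho -> exists R0, forall r, R0 <= r ->
  g <= ln (ln (max_modulus (W L) r)) / ln r.
Proof.
move=> g0 grho; pose g' := (g + rho) / 2.
have gg' : g < g' by rewrite /g'; lra.
have [|c [R0 [c0 R01 h]]] := @log_w22_ge_power g' _ ltac:(by rewrite /g'; lra).
  by rewrite /g'; lra.
exists (R0 + expR (`|ln c| / (g' - g)) + 1) => r Rr.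
have e0 := expR_gt0 (`|ln c| / (g' - g)).
have r0 : 0 < r by lra.
have lr : 0 < ln r by rewrite ln_gt0 //; lra.
have k1 := h r ltac:(lra).
have p0 : 0 < c * r `^ g' by rewrite mulr_gt0 // powR_gt0.
have w0 : 0 < w22 r.
  rewrite ltNge; apply/negP => w0; have := lt_le_trans p0 k1.
  by rewrite ln0 ?ltxx.
have k2 : c * r `^ g' <= ln (max_modulus (W L) r).
  apply: (le_trans k1); have wm := w22_le_max_modulus (ltW r0).
  by rewrite ler_ln ?posrE // (lt_le_trans w0).
have k3 : ln c + g' * ln r <= ln (ln (max_modulus (W L) r)).
  by rewrite -ln_powR -lnM ?posrE ?powR_gt0 // ler_ln ?posrE // (lt_le_trans p0).
rewrite ler_pdivlMr //; apply: le_trans k3.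
have k4 : `|ln c| <= (g' - g) * ln r.
  rewrite -ler_pdivrMl ?subr_gt0 // mulrC.
  by rewrite -(expRK (`|ln c| / (g' - g))) ler_ln ?posrE //; lra.
have := ler_norm (- ln c); rewrite normrN; lra.
Qed.

Lemma growth_order_lower_bound : (rho%:E <= growth_order (W L))%E.
Proof.
rewrite /growth_order limf_esupE; apply: le_ereal_inf_tmp => _ [V [M [_ hM]] <-].
rewrite leNgt; apply/negP => lt.
have [g [g0 grho gs]] : exists g, [/\ 0 < g, g < rho &
   (ereal_sup [set (ln (ln (max_modulus (W L) r)) / ln r)%:E | r in V] < g%:E)%E].
  move: lt; case: (ereal_sup _) => [s| |] //=.
    rewrite lte_fin => sr; have r0 := rho_gt0.
    exists ((Num.max s 0 + rho) / 2); have m0 : 0 <= Num.max s 0 by rewrite le_max lexx orbT.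
    have ms : s <= Num.max s 0 by rewrite le_max lexx.
    have mr : Num.max s 0 < rho by rewrite gt_max sr.
    by split; rewrite ?lte_fin; lra.
  move=> _; exists (rho / 2); have r0 := rho_gt0.
  by split; [lra|lra|exact: ltNyr].
have [R0 hR] := loglog_large g0 grho.
pose r := Num.max R0 (M + 1).
have Vr : V r by apply: hM; rewrite /r lt_max ltrDl ltr01 orbT.
have : (g%:E <= (ln (ln (max_modulus (W L) r)) / ln r)%:E)%E.
  by rewrite lee_fin hR // /r le_max lexx.
apply/negP; rewrite -ltNge; apply: le_lt_trans gs.
by apply: ereal_sup_ubound; exists r.
Qed.

End Final.

Theorem theorem1p1 (R : realType) (H : R -> 'M[R]_2) (l phi : nat -> R)
  (W : R -> R[i] -> 'M[R[i]]_2) (dl dphi : R -> R) (delta_l delta_phi : R)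
  (hH : hamburger_hamiltonian l phi H)
  (hW : forall z : R[i],
     fundamental_solution H (total_length l) z (fun t => W t z))
  (hdl : regularly_varying dl (- delta_l))
  (hdphi : regularly_varying dphi (- delta_phi))
  (hdelta : 0 < delta_phi < 1)
  (hl : lesssim \oo (fun j : nat => (dl j%:R)%:E) (fun j => (l j)%:E))
  (hphi : asymp \oo (fun j : nat => `|phi j.+1 - phi j|%:E)
                    (fun j => (dphi j%:R)%:E))
  (hmon : eventually_monotone phi) :
  lesssim (pinfty_nbhs R)
    (fun r : R => r%:E *
       \int[lebesgue_measure]_(x in
         `[asymptotic_inverse (fun t => dphi t / dl t)%R r, +oo[) (dl x)%:E)%E
    (fun r : R => (ln (cmod (W (total_length l) (0 +i* r) 1 1)))%:E)
  /\ (((1 - delta_phi) / (delta_l - delta_phi))%:E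
        <= growth_order (W (total_length l)))%E.
Proof.
split.
  exact: (log_w22_lower_bound hH hW hdl hdphi hdelta hl hphi hmon).
exact: (growth_order_lower_bound hH hW hdl hdphi hdelta hl hphi hmon).
Qed.
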